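(* For all positive integers $a$ and $b$, the following are equivalent: (i) every bipartite planar graph is $(a:b)$-choosable; (ii) $\frac{a}{b} \ge 3$.
   Context: All graphs are finite and simple. For an assignment $L$ of lists (finite sets) of colors to the vertices of a graph $G$, a $b$-fold $L$-coloring of $G$ is a mapping $\varphi$ that assigns to each vertex $v$ a set $\varphi(v)\subseteq L(v)$ with $|\varphi(v)| = b$, such that $\varphi(u)\cap\varphi(v)=\varnothing$ whenever $u$ and $v$ are adjacent. For positive integers $a,b$, a graph $G$ is $(a:b)$-choosable if, for each list assignment $L$ with $|L(v)| = a$ for every vertex $v$, $G$ admits a $b$-fold $L$-coloring. *)

(* Defs.v *)
From HB Require Import structures.
From mathcomp Require Import all_boot all_order all_algebra.
From mathcomp Require Import finmap.
From mathcomp Require Import reals.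

Set Implicit Arguments.
Unset Strict Implicit.
Unset Printing Implicit Defensive.

Import Order.TTheory GRing.Theory Num.Theory.

Local Open Scope ring_scope.

Record sgraph := SGraph {
  vertex :> finType;
  adj : rel vertex;
  adj_sym : symmetric adj;
  adj_irrefl : irreflexive adj
}.

Definition bipartite (G : sgraph) : Prop :=
  exists c : G -> bool, forall u v : G, adj u v -> c u != c v.

Definition fold_coloring (G : sgraph) (C : choiceType) (b : nat)
    (L : G -> {fset C}) (phi : G -> {fset C}) : Prop :=
  [/\ forall v : G, (phi v `<=` L v)%fset,
      forall v : G, #|` phi v| = b
    & forall u v : G, adj u v -> (phi u `&` phi v)%fset = fset0].

Definition choosable (a b : nat) (G : sgraph) : Prop :=
  forall (C : choiceType) (L : G -> {fset C}),
    (forall v : G, #|` L v| = a) ->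
    exists phi : G -> {fset C}, fold_coloring b L phi.

(* Planarity is existence of a drawing in the real plane in the sense of      *)
(* Diestel's Graph Theory: edges are drawn as polygonal arcs, that is, simple *)
(* curves made of finitely many straight line segments.                       *)

Section Planarity.
Variable R : realType.

Notation point := 'rV[R]_2.

Definition on_segment (p q x : point) : Prop :=
  exists2 t : R, 0 <= t <= 1 & x = (1 - t) *: p + t *: q.

(* A polygonal line is given by the sequence of its successive corners,       *)
(* including both ends.                                                       *)
Definition on_polyline (s : seq point) (x : point) : Prop :=
  exists2 i : nat, (i.+1 < size s)%N & on_segment s`_i s`_i.+1 x.

(* The last clause says that the line does not cross or touch itself: two     *)
(* distinct segments meet only if they are consecutive, and then only in      *)
(* their common corner.                                                       *)
Definition polygonal_arc (p q : point) (s : seq point) : Prop :=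
  [/\ (1 < size s)%N, uniq s, head 0 s = p, last 0 s = q
    & forall (i j : nat) (x : point), (i < j)%N -> (j.+1 < size s)%N ->
        on_segment s`_i s`_i.+1 x -> on_segment s`_j s`_j.+1 x ->
        j = i.+1 /\ x = s`_j].

(* An edge uv is seen both as (u, v) and as (v, u); arc_rev forces the two    *)
(* orientations to be drawn as the same arc.                                  *)
Record drawing (G : sgraph) := Drawing {
  pos : G -> point;
  arc : G -> G -> seq point;
  pos_inj : injective pos;
  arc_rev : forall u v : G, adj u v -> arc v u = rev (arc u v);
  arcP : forall u v : G, adj u v -> polygonal_arc (pos u) (pos v) (arc u v);
  arc_vertex : forall u v w : G,
    adj u v -> on_polyline (arc u v) (pos w) -> w = u \/ w = v;
  arc_disjoint : forall (u v u' v' : G) (x : point),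
    adj u v -> adj u' v' -> [set u; v] != [set u'; v'] ->
    on_polyline (arc u v) x -> on_polyline (arc u' v') x ->
    x = pos u \/ x = pos v
}.

Definition planar (G : sgraph) : Prop := inhabited (drawing G).

End Planarity.

(* Main.v *)
(* If a < 3b, take K_(2,n): the two vertices of large degree get disjoint lists,
   and for every choice of two b-sets on them some common neighbour is left
   with fewer than b colors.

   If a >= 3b, a bipartite planar graph satisfies E <= 2V, as do its subgraphs,
   so it has an orientation with outdegrees at most 2.  Bipartite digraphs have
   kernels, and coloring kernels one color at a time succeeds as soon as every
   list has b (1 + outdegree) elements.

   The edge bound needs E - V <= F only, and this inequality does not require
   the Jordan curve theorem (MacLane's argument): for an even edge set z, the
   parity with which z surrounds a point is constant along each face boundary
   and jumps exactly at the edges of z, so that the 2^(E - V) or more even edge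
   sets inject into the sets of faces.  Faces are orbits of darts under a
   rotation system; in a bipartite graph of minimum degree 2 they have length
   at least 4, hence 4F <= 2E. *)

From mathcomp Require Import all_boot all_order all_algebra.
From mathcomp Require Import finmap reals zify ring lra.
Require Import Defs.

Set Implicit Arguments.
Unset Strict Implicit.
Unset Printing Implicit Defensive.

Import Order.TTheory GRing.Theory Num.Theory.

(** * Kernels and multicolorings *)

(** Induction on the size of [S]. If every false vertex of [S] has an out-neighbour among the true
    ones, the latter form a kernel. Otherwise some false vertex [u] is a sink in [S]; it joins a
    kernel of what remains after deleting [u] and its in-neighbours. *)
Lemma bipartite_kernel (V : finType) (c : V -> bool) (out : rel V)
    (S : {set V}) :
  (forall u v, out u v -> c u != c v) ->
  exists K : {set V},
    [/\ K \subset S, {in K &, forall u v, ~~ out u v}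
      & {in S :\: K, forall u, exists2 v, v \in K & out u v}].
Proof.
move=> cP; have [n] := ubnP #|S|; elim: n S => // n IHn S leSn.
have [allB|] :=
    boolP [forall u in S, ~~ c u ==> [exists v in S, c v && out u v]].
  exists [set u in S | c u]; split=> [|u v|u].
  - by apply/subsetP=> u; rewrite inE => /andP[].
  - rewrite !inE => /andP[_ cu] /andP[_ cv].
    by apply/negP=> /cP; rewrite cu cv.
  - rewrite !inE => /andP[]; case: (boolP (u \in S)) => //= uS ncu _.
    move/forall_inP: allB => /(_ u uS); rewrite ncu.
    by case/exists_inP=> v vS /andP[cv uv]; exists v; rewrite ?inE ?vS.
rewrite negb_forall_in => /exists_inP[u uS].
rewrite negb_imply => /andP[ncu /exists_inPn noout].
have sink v : v \in S -> ~~ out u v.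
  move=> vS; apply/negP=> uv; have := noout v vS; have := cP _ _ uv.
  by rewrite uv andbT; case: (c u) (c v) ncu => -[].
pose S' := [set v in S | (v != u) && ~~ out v u].
have ltS'S : #|S'| < #|S|.
  apply: proper_card; apply/properP; split; last first.
    by exists u; rewrite ?inE ?eqxx ?andbF.
  by apply/subsetP=> v; rewrite !inE => /and3P[].
have [|K [subK indK absK]] := IHn S'; first by rewrite -ltnS (leq_trans _ leSn).
have KS' v : v \in K -> [/\ v \in S, v != u & ~~ out v u].
  by move=> /(subsetP subK); rewrite inE => /and3P[].
exists (u |: K); split=> [|v w|v].
- by apply/subsetP=> v /setU1P[->//|/KS'[]].
- move=> /setU1P[->|vK] /setU1P[->|wK]; last exact: indK.
  + by apply/negP=> /cP; rewrite eqxx.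
  + by case: (KS' w wK) => /sink.
  + by case: (KS' v vK).
rewrite !inE negb_or => /andP[/andP[vu vK] vS].
have [vou|nvu] := boolP (out v u); first by exists u; rewrite ?setU11.
have [|w wK vw] := absK v; first by rewrite !inE vK vS vu.
by exists w => //; rewrite setU1r.
Qed.

(* One color is spent at a time, on a kernel of the vertices that still need
   colors and have it in their list; this preserves the bound on need. *)
Lemma kernel_multicoloring (V : finType) (c : V -> bool) (out : rel V)
    (C : choiceType) (need : V -> nat) (L : V -> {fset C}) :
  (forall u v, out u v -> c u != c v) ->
  (forall u, 0 < need u -> need u + \sum_(v | out u v) need v <= #|` L u|) ->
  exists phi : V -> {fset C},
    [/\ forall u, (phi u `<=` L u)%fset, forall u, #|` phi u| = need u
      & forall u v, out u v -> (phi u `&` phi v)%fset = fset0].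
Proof.
move=> cP; have [n] := ubnP (\sum_v need v).
elim: n need L => // n IHn need L leLn needP.
have [need0|] := boolP [forall u, need u == 0].
  exists (fun=> fset0); split=> [u|u|u v _]; rewrite ?fsub0set ?fset0I //.
  by rewrite cardfs0 (eqP (forallP need0 u)).
rewrite negb_forall => /existsP[u0]; rewrite -lt0n => u0_gt0.
have /fset0Pn[x xL] : L u0 != fset0.
  by rewrite -cardfs_gt0 (leq_trans _ (needP u0 u0_gt0)) // addn_gt0 u0_gt0.
pose S := [set u | (x \in L u) && (0 < need u)].
have [K [/subsetP subK indK absK]] := bipartite_kernel S cP.
have KS u : u \in K -> x \in L u /\ 0 < need u.
  by move=> /subK; rewrite inE => /andP[].
pose need' u := need u - (u \in K).
pose L' u := (L u `\ x)%fset.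
have le_need u : need' u <= need u by exact: leq_subr.
have [||phi [phiL phin phiD]] := IHn need' L'.
- rewrite -ltnS (leq_trans _ leLn) // ltnS.
  (* [K] contains [u0] or an out-neighbour of it, so the total need drops. *)
  have [u uK] : exists u, u \in K.
    case: (boolP (u0 \in K)) => [|u0K]; first by exists u0.
    by have [|v vK _] := absK u0; [rewrite !inE u0K xL | exists v].
  rewrite (bigD1 u) //= [X in _ < X](bigD1 u) //= -addSn leq_add ?leq_sum //.
  by have [_] := KS u uK; rewrite /need' uK subn1 => /prednK->.
- move=> u need'u; have needu := leq_trans need'u (le_need u).
  have leN : \sum_(v | out u v) need' v <= \sum_(v | out u v) need v.
    by apply: leq_sum.
  have := needP u needu; rewrite (cardfsD1 x (L u)) -/(L' u).
  (* When [u] loses x, the amount required drops as well: at [u] itself if [u] is in [K], and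
     otherwise at an out-neighbour in [K]. *)
  have [xLu|_] := boolP (x \in L u); last first.
    by rewrite add0n; apply: leq_trans; rewrite leq_add.
  have [uK|uK] := boolP (u \in K).
    by move: need'u leN; rewrite /need' uK; lia.
  have [|v vK uv] := absK u; first by rewrite !inE uK xLu.
  move: leN; rewrite !(bigD1 v uv) /= => _.
  have : \sum_(i | out u i && (i != v)) need' i
         <= \sum_(i | out u i && (i != v)) need i by apply: leq_sum.
  have need'v : need' v = need v - 1 by rewrite /need' vK.
  by have [_] := KS v vK; move: (le_need u); rewrite need'v; lia.
have xphi u : x \notin phi u.
  by apply/negP=> /(fsubsetP (phiL u)); rewrite !inE eqxx.
exists (fun u => if u \in K then x |` phi u else phi u)%fset.
have subL u : (phi u `<=` L u)%fset.
  exact: fsubset_trans (phiL u) (fsubsetDl _ _).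
split=> [u|u|u v uv].
- by case: ifP => // /KS[xLu _]; rewrite fsubUset fsub1set xLu subL.
- have := phin u; rewrite /need'; case: ifP => [uK|_]; last by rewrite subn0.
  by rewrite cardfsU1 xphi => ->; have [_] := KS u uK; lia.
have D := phiD u v uv; have Dx y : y \in phi u -> y \notin phi v.
  move=> yu; apply/negP=> yv; have : y \in (phi u `&` phi v)%fset.
    by rewrite inE yu.
  by rewrite D inE.
apply/eqP; apply/fset0Pn => -[y].
have [uK|uK] := boolP (u \in K); have [vK|vK] := boolP (v \in K).
- by move: (indK u v uK vK); rewrite uv.
- by rewrite !inE => /andP[/orP[/eqP->|/Dx/negP//]]; move/negP: (xphi v).
- by rewrite !inE => /andP[yu /orP[/eqP yx|/(negP (Dx y yu))//]];
     move: yu; rewrite yx; move/negP: (xphi u).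
- by rewrite inE => /andP[/Dx/negP].
Qed.

(** * Orientations with bounded outdegrees *)

Definition spanned (V : finType) (F : {set V * V}) (U : {set V}) :=
  [set p in F | (p.1 \in U) && (p.2 \in U)].

(* Tight sets containing u but not v and v but not u cannot coexist, since the
   edge uv is spanned by their union only. *)
Lemma in_spanned (V : finType) (F : {set V * V}) (U : {set V}) (p : V * V) :
  (p \in spanned F U) = [&& p \in F, p.1 \in U & p.2 \in U].
Proof. by rewrite inE. Qed.

(** Hakimi's criterion, by induction on |F|: an edge [e] is given to one of its ends, whose capacity
    drops by one. This is impossible only if a tight set contains that end but not both ends. *)
Lemma bounded_orientation (V : finType) (F : {set V * V}) (cap : V -> nat) :
  (forall U : {set V}, #|spanned F U| <= \sum_(v in U) cap v) ->
  exists f : V * V -> V,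
    (forall p, p \in F -> f p = p.1 \/ f p = p.2) /\
    (forall v, #|[set p in F | f p == v]| <= cap v).
Proof.
have [n] := ubnP #|F|; elim: n F cap => // n IHn F cap leFn capP.
have [F0|[e eF]] := set_0Vmem F.
  exists fst; split=> [p|v]; first by rewrite F0 inE.
  by rewrite (eq_card (_ : _ =i pred0)) ?card0 // => p; rewrite F0 !inE.
have assign u : (u = e.1 \/ u = e.2) ->
    (forall U : {set V}, u \in U -> ~~ ((e.1 \in U) && (e.2 \in U)) ->
       #|spanned F U| < \sum_(v in U) cap v) ->
    exists f : V * V -> V,
      (forall p, p \in F -> f p = p.1 \/ f p = p.2) /\
      (forall v, #|[set p in F | f p == v]| <= cap v).
  move=> eu slack.
  pose cap' v := cap v - (v == u).
  have capu : 0 < cap u.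
    have := capP [set u]; have := slack [set u] (set11 u).
    rewrite big_set1 !inE.
    (* If [e] is a loop at [u], it is spanned by {u}, and [capP] gives the bound. *)
    case: (boolP (_ && _)) => [|_ /(_ isT)]; last by lia.
    move=> eu' _; apply: leq_trans; rewrite card_gt0; apply/set0Pn.
    by exists e; rewrite !(in_spanned, inE) eF.
  have cap'P (U : {set V}) :
      \sum_(v in U) cap' v = \sum_(v in U) cap v - (u \in U).
    have [uU|uU] := boolP (u \in U).
      rewrite !(bigD1 u uU) /= {1}/cap' eqxx.
      suff -> : \sum_(i in U | i != u) cap' i = \sum_(i in U | i != u) cap i.
        by rewrite addnBAC.
      by apply: eq_bigr => i /andP[_ /negPf iu]; rewrite /cap' iu subn0.
    rewrite subn0; apply: eq_bigr => i iU; rewrite /cap'.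
    by case: eqP => [iu|_]; rewrite ?subn0 //; rewrite -iu iU in uU.
  have [||f [fF fcap]] := IHn (F :\ e) cap'.
  - by rewrite -ltnS (leq_trans _ leFn) // [X in _ < X.+1](cardsD1 e) eF.
  - move=> U; rewrite cap'P.
    have sE : spanned (F :\ e) U = spanned F U :\ e.
      by apply/setP=> p; rewrite !(in_spanned, inE) -!andbA.
    have := cardsD1 e (spanned F U); rewrite -sE !(in_spanned, inE) eF /=.
    have := capP U; have := slack U.
    case: (u \in U); case: (_ && _) => /= slackU;
      try have := slackU isT isT; lia.
  exists (fun p => if p == e then u else f p); split=> [p pF|v].
    case: eqP => [->|/eqP pe]; first by case: eu; auto.
    by apply: fF; rewrite !inE pe.
  apply: leq_trans (_ : #|[set p in F :\ e | f p == v]| + (v == u) <= _).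
    rewrite (cardsD1 e) !inE eF eqxx eq_sym addnC leq_add2r subset_leq_card //.
    by apply/subsetP=> p; rewrite !inE; case: eqP.
  by have := fcap v; rewrite /cap'; case: eqP => [->|_]; lia.
pose tight u (U : {set V}) := [&& u \in U, ~~ ((e.1 \in U) && (e.2 \in U))
  & \sum_(v in U) cap v <= #|spanned F U|].
have [/existsP[U1 /and3P[e1U1 eU1 tU1]]|no1] := boolP [exists U, tight e.1 U];
    last first.
  apply: (assign e.1) => [|U e1U eU]; first by left.
  rewrite ltnNge; apply/negP=> tU; case/existsP: no1; exists U.
  by apply/and3P.
have [/existsP[U2 /and3P[e2U2 eU2 tU2]]|no2] := boolP [exists U, tight e.2 U];
    last first.
  apply: (assign e.2) => [|U e2U eU]; first by right.
  rewrite ltnNge; apply/negP=> tU; case/existsP: no2; exists U.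
  by apply/and3P.
have sumUI : \sum_(v in U1 :|: U2) cap v + \sum_(v in U1 :&: U2) cap v
           = \sum_(v in U1) cap v + \sum_(v in U2) cap v.
  rewrite !(big_mkcond (fun v => v \in _)) -!big_split.
  apply: eq_bigr => v _ /=.
  by rewrite !inE; case: (v \in U1); case: (v \in U2); rewrite ?addn0 // addnC.
have cardUI : #|spanned F U1| + #|spanned F U2| <
              #|spanned F (U1 :|: U2)| + #|spanned F (U1 :&: U2)|.
  rewrite -cardsUI -addSn leq_add //; last first.
    apply/subset_leq_card/subsetP=> p; rewrite !(in_spanned, inE).
    by move=> /andP[/and3P[-> -> ->] /and3P[_ -> ->]].
  apply: proper_card; apply/properP; split.
    apply/subsetP=> p; rewrite !(in_spanned, inE).
    by move=> /orP[]/and3P[-> -> ->]; rewrite ?orbT.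
  exists e; first by rewrite !(in_spanned, inE) eF e1U1 e2U2 orbT.
  rewrite !(in_spanned, inE) eF /= negb_or eU1 /=; exact: eU2.
by have := capP (U1 :|: U2); have := capP (U1 :&: U2); lia.
Qed.

(** * Crossing parities in straight line drawings *)

(** Edge sets are vectors over GF(2), given by their indicator functions [z]. *)
Definition xsum (K : finType) (z : K -> bool) (P : pred K) : bool :=
  \big[addb/false]_k (P k && z k).

Section Xsum.
Variables (K : finType) (z : K -> bool).
Local Notation xsum := (xsum z).

Lemma eq_xsum P Q : P =1 Q -> xsum P = xsum Q.
Proof. by move=> eqPQ; apply: eq_bigr => k _; rewrite eqPQ. Qed.

Lemma xsum0 : xsum pred0 = false.
Proof. exact: big1_eq. Qed.

Lemma xsumD P Q : xsum (fun k => P k (+) Q k) = xsum P (+) xsum Q.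
Proof. by rewrite -big_split; apply: eq_bigr => k _; rewrite andb_addl. Qed.

Lemma xsum_eq P Q : xsum (fun k => P k (+) Q k) = false -> xsum P = xsum Q.
Proof. by rewrite xsumD; case: (xsum P) (xsum Q) => -[]. Qed.

Lemma xsum1 k0 : xsum (pred1 k0) = z k0.
Proof.
rewrite /xsum (bigD1 k0) //= eqxx big1 ?addbF // => k /negPf kk0.
by rewrite kk0.
Qed.

Lemma xsum_rev rev P : involutive rev -> (forall k, z (rev k) = z k) ->
  xsum (fun k => P (rev k)) = xsum P.
Proof.
move=> revK zrev; rewrite /xsum [RHS](reindex_inj (can_inj revK)) /=.
by apply: eq_bigr => k _; rewrite zrev.
Qed.

(** The pullback of [Q] is a union of fibers of [f], each of even parity; [h] picks a representative
    in each fiber. *)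
Lemma xsum_fibers (T : eqType) (f : K -> T) (Q : pred T) :
  (forall k0, xsum (fun k => f k == f k0) = false) ->
  xsum (fun k => Q (f k)) = false.
Proof.
move=> fib0; pose h k := odflt k [pick k' | f k' == f k].
have fh k : f (h k) = f k.
  by rewrite /h; case: pickP => //= k' /eqP.
have hE k k0 : (h k == h k0) = (f k == f k0).
  apply/eqP/eqP=> [eqh|eqf]; first by rewrite -fh eqh fh.
  rewrite /h eqf; case: pickP => //= /(_ k0).
  by rewrite eqxx.
rewrite /xsum (partition_big h xpredT) //= big1 // => k0 _.
have [k0h|k0h] := eqVneq (h k0) k0; last first.
  apply: big1 => k /eqP hk; case/negP: k0h.
  by rewrite -hk hE fh.
have [Q0|nQ0] := boolP (Q (f k0)); last first.
  by apply: big1 => k /eqP hk; rewrite -fh hk (negPf nQ0).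
rewrite big_mkcond; apply: etrans (fib0 k0); apply: eq_bigr => k _.
rewrite -hE k0h; case: eqP => // hk.
by rewrite -fh hk Q0.
Qed.

End Xsum.

(* A straight line drawing without vertical segments: each segment is given by
   its two darts k and rev k, and X k, Y k are the coordinates of the origin
   of k. *)
Section Sweep.
Local Open Scope ring_scope.
Variables (R : realFieldType) (K : finType) (rev : K -> K) (X Y : K -> R).

Definition slope k := (Y (rev k) - Y k) / (X (rev k) - X k).
Definition line k t := Y k + (t - X k) * slope k.
Definition rightward k := X k < X (rev k).
Definition same_origin j k := (X j == X k) && (Y j == Y k).
Definition spans k t := X k <= t <= X (rev k).

Hypothesis revK : involutive rev.
Hypothesis X_rev : forall k, X (rev k) != X k.
Hypothesis noncrossing : forall j k t, rightward j -> rightward k -> j != k ->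
  spans j t -> spans k t -> line j t = line k t -> t = X j \/ t = X (rev j).

Lemma slope_rev k : slope (rev k) = slope k.
Proof. by rewrite /slope revK -opprB -[X in _ / X]opprB invrN mulrNN. Qed.

Lemma line_origin k : line k (X k) = Y k.
Proof. by rewrite /line subrr mul0r addr0. Qed.

Lemma line_rev k t : line (rev k) t = line k t.
Proof.
rewrite /line slope_rev /slope; have := X_rev k; rewrite -subr_eq0 => Xk.
by field.
Qed.

Lemma rightward_rev k : rightward (rev k) = ~~ rightward k.
Proof. by rewrite /rightward revK -leNgt le_eqVlt (negPf (X_rev k)). Qed.

(** * Vertical order of noncrossing segments *)

Definition overlap j k := (X j < X (rev k)) && (X k < X (rev j)).

(** The middle of the common abscissa interval of two overlapping segments is a mere sample point:
    by [aboveE] their order is the same at every abscissa of the interval where their heights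
    differ. *)
Definition mid j k : R :=
  (Num.max (X j) (X k) + Num.min (X (rev j)) (X (rev k))) / 2.

Definition above j k := line k (mid j k) < line j (mid j k).

Lemma midP j k : rightward j -> rightward k -> overlap j k ->
  (X j < mid j k < X (rev j)) && (X k < mid j k < X (rev k)).
Proof.
rewrite /rightward /overlap /mid => rj rk /andP[jk kj].
case: (leP (X j) (X k)) => ?; case: (leP (X (rev j)) (X (rev k))) => ?;
  do ![apply/andP; split]; lra.
Qed.

Lemma line_neq j k t : rightward j -> rightward k -> j != k ->
  spans j t -> spans k t -> t != X j -> t != X (rev j) -> line j t != line k t.
Proof.
move=> rj rk jk sj sk t1 t2; apply/eqP=> e.
by have [/eqP|/eqP] := noncrossing rj rk jk sj sk e; apply/negP.
Qed.

Lemma aboveE j k t : rightward j -> rightward k -> j != k -> overlap j k ->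
  spans j t -> spans k t -> line j t != line k t ->
  above j k = (line k t < line j t).
Proof.
move=> rj rk jk ov sj sk ne; rewrite /above.
have /andP[/andP[m1 m2] /andP[m3 m4]] := midP rj rk ov.
set m := mid j k in m1 m2 m3 m4 *.
have nem : line j m != line k m.
  by apply: line_neq; rewrite // /spans ?ltW ?(gt_eqF m1) ?(lt_eqF m2).
(* if the two affine functions compare differently at m and at t, they agree
   strictly between m and t, which noncrossing excludes *)
pose h x := line j x - line k x.
have hE x : h x = h 0 + x * (slope j - slope k) by rewrite /h /line; ring.
have nocross : 0 <= h m * h t.
  (* [l] is the weight that makes the combination [r] of [m] and [t] a zero of the affine function
     [h]. As [m] is interior to both segments and [l] is positive, so is [r] interior. *)
  rewrite leNgt; apply/negP=> hmt; pose l := h t / (h t - h m).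
  have [lI hmtN] : 0 < l < 1 /\ h t - h m != 0.
    have [hm|hm|hm] := ltgtP (h m) 0; last by rewrite hm mul0r ltxx in hmt.
    - have ht : 0 < h t by rewrite -(nmulr_rlt0 _ hm).
      have d : 0 < h t - h m by lra.
      by rewrite gt_eqF // divr_gt0 //= ltr_pdivrMr // mul1r; split=> //; lra.
    - have ht : h t < 0 by rewrite -(pmulr_rlt0 _ hm).
      have d : h t - h m < 0 by lra.
      rewrite lt_eqF // nmulr_rgt0 ?invr_lt0 // d /= ltr_ndivrMr // mul1r.
      by split=> //; lra.
  pose r := l * m + (1 - l) * t.
  have hr : h r = 0.
    suff -> : h r = l * h m + (1 - l) * h t by rewrite /l; field.
    by rewrite (hE r) (hE m) (hE t) /r; ring.
  have : line j r != line k r.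
    move: lI sj sk; rewrite /spans => /andP[? ?] /andP[? ?] /andP[? ?].
    have lt_r a : a < m -> a <= t -> a < r.
      move=> am at_; rewrite -subr_gt0.
      have -> : r - a = l * (m - a) + (1 - l) * (t - a) by rewrite /r; ring.
      by apply: ltr_pwDl; [apply: mulr_gt0 | apply: mulr_ge0]; lra.
    have gt_r a : m < a -> t <= a -> r < a.
      move=> am at_; rewrite -subr_gt0.
      have -> : a - r = l * (a - m) + (1 - l) * (a - t) by rewrite /r; ring.
      by apply: ltr_pwDl; [apply: mulr_gt0 | apply: mulr_ge0]; lra.
    have [r1 r2] : X j < r /\ r < X (rev j) by auto.
    have [r3 r4] : X k < r /\ r < X (rev k) by auto.
    by apply: line_neq; rewrite // /spans ?ltW ?(gt_eqF r1) ?(lt_eqF r2).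
  by rewrite -subr_eq0 -/(h r) hr eqxx.
rewrite -subr_gt0 -[RHS]subr_gt0 -/(h m) -/(h t).
move: nem ne; rewrite -subr_eq0 -[_ == line k t]subr_eq0 -/(h m) -/(h t).
move: nocross; have [hm|hm|//] := ltgtP (h m) 0 => nocross _ ht.
  by apply/esym/negbTE; rewrite -leNgt -(nmulr_rge0 _ hm).
by apply/esym; rewrite lt_neqAle eq_sym ht -(pmulr_rge0 _ hm).
Qed.

Lemma abovekk k : above k k = false.
Proof. exact: ltxx. Qed.

Lemma spans_origin k : rightward k -> spans k (X k).
Proof. by move=> rk; rewrite /spans lexx ltW. Qed.

Lemma spans_end k : rightward k -> spans k (X (rev k)).
Proof. by move=> rk; rewrite /spans lexx ltW. Qed.

Lemma line_end k : line k (X (rev k)) = Y (rev k).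
Proof. by rewrite -line_rev line_origin. Qed.

Lemma slope_neq j k t : rightward j -> rightward k -> j != k -> overlap j k ->
  line j t = line k t -> slope j != slope k.
Proof.
move=> rj rk jk ov e; apply/eqP=> es.
have /andP[/andP[m1 m2] /andP[m3 m4]] := midP rj rk ov.
have /eqP[] : line j (mid j k) != line k (mid j k).
  by apply: line_neq; rewrite // /spans ?ltW ?(gt_eqF m1) ?(lt_eqF m2).
by move: e; rewrite /line es; lra.
Qed.

(** * Crossing parities of an even set of segments *)

Variable z : K -> bool.
Hypothesis z_rev : forall k, z (rev k) = z k.
Hypothesis z_even : forall k0, xsum z (same_origin^~ k0) = false.

(** Each point is the origin of evenly many darts of [z], so a condition on origins alone selects an
    even number. *)
Lemma xsum_points (Q : R -> R -> bool) :
  xsum z (fun k => Q (X k) (Y k)) = false.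
Proof.
apply: (xsum_fibers (f := fun k => (X k, Y k)) (fun p => Q p.1 p.2)) => k0.
by rewrite -[RHS](z_even k0); apply: eq_xsum => k; rewrite xpair_eqE.
Qed.

(** Joins the contributions of the two darts of a segment under the rightward one. *)
Lemma xsum_segments P :
  xsum z P = xsum z (fun k => rightward k && (P k (+) P (rev k))).
Proof.
transitivity (xsum z (fun k => rightward k && P k (+) ~~ rightward k && P k)).
  by apply: eq_xsum => k; case: (rightward k); rewrite ?addbF.
rewrite xsumD -(xsum_rev (fun k => ~~ rightward k && P k) revK z_rev) -xsumD.
by apply: eq_xsum => k; rewrite rightward_rev negbK; case: (rightward k).
Qed.

(** For a rightward [k], the segments of [z] above it are counted just after its left end here, and
    just before its right end in [near_right]; hence the half-open conditions. *)
Definition near_left k := xsum z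
  (fun j => rightward j && [&& X j <= X k, X k < X (rev j) & above j k]).

Definition near_right k := xsum z
  (fun j => rightward j &&
            [&& X j < X (rev k), X (rev k) <= X (rev j) & above j k]).

(* A point passed while sweeping from one end of the segment to the other
   contributes its whole degree. *)
Lemma near_left_right k : rightward k -> near_left k = near_right k.
Proof.
move=> rk; apply: xsum_eq.
rewrite -[RHS](xsum_points
  (fun x y => [&& X k < x, x < X (rev k) & line k x < y])) [RHS]xsum_segments.
apply: eq_xsum => j; have [rj|] := boolP (rightward j); rewrite /= ?andbF //.
have [->|jk] := eqVneq j k.
  by rewrite abovekk !ltxx !andbF.
have [ov|nov] := boolP (overlap j k); last first.
  have F (x y : R) : y < x -> (x <= y) = false by move=> ?; exact/lt_geF.
  have G (x y : R) : y <= x -> (x < y) = false by move=> ?; exact/le_gtF.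
  move: nov rj rk; rewrite /overlap /rightward negb_and -!leNgt.
  move=> /orP[] h rj rk.
    by rewrite (F (X j)) ?(G (X j)) ?(G (X (rev j))) ?andbF //; lra.
  by rewrite (F (X (rev k))) ?(G (X k) (X j)) ?(G (X k)) ?andbF //; lra.
(* An end of [j] strictly between the ends of [k] shows by its height whether [j] is above [k]. *)
have Pj : X k < X j -> X j < X (rev k) -> above j k = (line k (X j) < Y j).
  move=> kj jrk; have sj := spans_origin rj.
  have sk : spans k (X j) by rewrite /spans !ltW.
  rewrite (aboveE rj rk jk ov sj sk) ?line_origin // -[Y j]line_origin eq_sym.
  by apply: line_neq; rewrite // ?(gt_eqF kj) ?(lt_eqF jrk) // eq_sym.
have Prj : X k < X (rev j) -> X (rev j) < X (rev k) ->
    above j k = (line k (X (rev j)) < Y (rev j)).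
  move=> kj jrk; have sj := spans_end rj.
  have sk : spans k (X (rev j)) by rewrite /spans !ltW.
  rewrite (aboveE rj rk jk ov sj sk) ?line_end // -[Y (rev j)]line_end eq_sym.
  by apply: line_neq; rewrite // ?(gt_eqF kj) ?(lt_eqF jrk) // eq_sym.
move: ov Pj Prj; rewrite /overlap /= => /andP[-> ->].
rewrite !(leNgt (X j)) !(leNgt (X (rev k))) /=.
case: (X k < X j) => /=; case: (X (rev j) < X (rev k)) => /=.
all: do 2![move=> /(_ isT isT) <- | move=> _]; by rewrite ?addbF ?addbb.
Qed.

(** Counts crossings of the open vertical ray above (x, y); a segment ending on the ray counts only
    if it extends to the right, or to the left in [over_left]. *)
Definition over_right x y := xsum z
  (fun j => rightward j && [&& X j <= x, x < X (rev j) & y < line j x]).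

Definition over_left x y := xsum z
  (fun j => rightward j && [&& X j < x, x <= X (rev j) & y < line j x]).

(** The two counts differ by the segment ends lying on the ray, an even number at each point. *)
Lemma over_left_right x y : over_right x y = over_left x y.
Proof.
apply: xsum_eq.
rewrite -[RHS](xsum_points (fun x' y' => (x == x') && (y < y'))).
rewrite [RHS]xsum_segments; apply: eq_xsum => j.
have [rj|] := boolP (rightward j); rewrite /= ?andbF //.
move: (rj); rewrite /rightward.
case: (ltgtP x (X j)) => [xj|jx|ex];
  case: (ltgtP x (X (rev j))) => [xrj|rjx|erx];
  rewrite /= ?addbb ?addbF // => jrj; try lra.
  by rewrite erx line_end.
by rewrite ex line_origin.
Qed.

(** A segment above [k] near its origin passes strictly over this origin or starts there with a
    larger slope. *)
Lemma near_left_origin k : rightward k ->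
  near_left k = over_right (X k) (Y k) (+)
    xsum z (fun j => [&& rightward j, same_origin j k & slope k < slope j]).
Proof.
move=> rk; rewrite -xsumD; apply: eq_xsum => j.
have [rj|] := boolP (rightward j); rewrite /= ?andbF //.
have [->|jk] := eqVneq j k.
  by rewrite abovekk line_origin !ltxx !andbF.
have sk := spans_origin rk.
have [/andP[/eqP Xjk /eqP Yjk]|njk] := boolP (same_origin j k).
  have ov : overlap j k by apply/andP; split; [rewrite Xjk | rewrite -Xjk].
  have /andP[/andP[m1 m2] /andP[m3 m4]] := midP rj rk ov.
  rewrite -Xjk line_origin Yjk ltxx lexx.
  move: (rj); rewrite /rightward => -> /=.
  rewrite /above /line Xjk Yjk.
  by rewrite ltrD2l ltr_pM2l // subr_gt0.
rewrite andFb addbF.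
have [jx|//] := boolP (X j <= X k); have [xj|//] := boolP (X k < X (rev j)).
have ov : overlap j k by rewrite /overlap xj (le_lt_trans jx).
have sj : spans j (X k) by rewrite /spans jx ltW.
rewrite /= (aboveE rj rk jk ov sj sk) ?line_origin //.
apply: contra njk => /eqP e.
have : line j (X k) = line k (X k) by rewrite line_origin.
move=> /(noncrossing rj rk jk sj sk)[Xkj|Xkj]; last by rewrite -Xkj ltxx in xj.
by rewrite /same_origin Xkj eqxx -e Xkj line_origin /=.
Qed.

(** Mirror image of [near_left_origin]: to the left of a common end, the higher segment has the
    smaller slope. *)
Lemma near_right_end k : rightward k ->
  near_right k = over_left (X (rev k)) (Y (rev k)) (+)
    xsum z (fun j => [&& rightward j, same_origin (rev j) (rev k)
                       & slope j < slope k]).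
Proof.
move=> rk; rewrite -xsumD; apply: eq_xsum => j.
have [rj|] := boolP (rightward j); rewrite /= ?andbF //.
have [->|jk] := eqVneq j k.
  by rewrite abovekk line_end !ltxx !andbF.
have sk := spans_end rk.
have [/andP[/eqP Xjk /eqP Yjk]|njk] := boolP (same_origin (rev j) (rev k)).
  have ov : overlap j k by apply/andP; split; [rewrite -Xjk | rewrite Xjk].
  have /andP[/andP[m1 m2] /andP[m3 m4]] := midP rj rk ov.
  rewrite -Xjk line_end Yjk ltxx lexx; move: (rj); rewrite /rightward => -> /=.
  rewrite /above -line_rev -(line_rev j) /line !slope_rev Xjk Yjk.
  by rewrite ltrD2l ltr_nM2l // subr_lt0.
rewrite andFb addbF.
have [jx|//] := boolP (X j < X (rev k)).
have [xj|//] := boolP (X (rev k) <= X (rev j)).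
have ov : overlap j k by rewrite /overlap jx (lt_le_trans _ xj).
have sj : spans j (X (rev k)) by rewrite /spans xj ltW.
rewrite /= (aboveE rj rk jk ov sj sk) ?line_end //.
apply: contra njk => /eqP e.
have : line j (X (rev k)) = line k (X (rev k)) by rewrite line_end.
move=> /(noncrossing rj rk jk sj sk)[Xkj|Xkj]; first by rewrite Xkj ltxx in jx.
by rewrite /same_origin Xkj eqxx -e Xkj line_end /=.
Qed.

(* The darts with a common origin in counterclockwise order, starting from the
   downward vertical. *)
Definition dart_key k : bool *l R := (~~ rightward k, slope k).

Lemma dart_keyE j k : (dart_key j < dart_key k)%O =
  if rightward j then ~~ rightward k || (slope j < slope k)
  else ~~ rightward k && (slope j < slope k).
Proof.
by rewrite /dart_key ltxi_pair; case: (rightward j); case: (rightward k).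
Qed.

(* Parity of the segments of z met by an upward ray starting immediately to the
   left of the dart k. *)
Definition left_side k :=
  if rightward k then near_left k else near_left (rev k) (+) z k.

(** The two sides of a segment differ by the crossing of the segment itself, seen from below
    only. *)
Lemma left_side_rev k : left_side (rev k) = left_side k (+) z k.
Proof.
rewrite /left_side rightward_rev; case: (rightward k) => /=.
  by rewrite revK z_rev.
by rewrite -addbA addbb addbF.
Qed.

(** Two darts leaving a point in the same direction would overlap. *)
Lemma dart_key_inj j k : same_origin j k -> dart_key j = dart_key k -> j = k.
Proof.
move=> /andP[/eqP Xjk /eqP Yjk] [rjk es]; apply/eqP/negPn/negP=> jk.
have ejk t : line j t = line k t by rewrite /line Xjk Yjk es.
have [rj|lj] := boolP (rightward j).
  have rk : rightward k by move: rjk; rewrite rj; case: (rightward k).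
  have ov : overlap j k by apply/andP; split; [rewrite Xjk | rewrite -Xjk].
  by have /eqP := slope_neq rj rk jk ov (ejk 0).
have rj : rightward (rev j) by rewrite rightward_rev.
have rk : rightward (rev k) by rewrite rightward_rev -rjk.
have ov : overlap (rev j) (rev k).
  by move: (rj) (rk); rewrite /rightward /overlap !revK Xjk => -> ->.
have rjk' : rev j != rev k by rewrite (inj_eq (can_inj revK)).
have e0 : line (rev j) 0 = line (rev k) 0 by rewrite !line_rev ejk.
by have := slope_neq rj rk rjk' ov e0; rewrite !slope_rev es eqxx.
Qed.

(** The parity seen just below the point: an upward ray shifted slightly to the left meets the
    leftward darts at the point and whatever passes over it. *)
Definition side_base (x y : R) := over_right x y (+)
  xsum z (fun j => ~~ rightward j && ((X j == x) && (Y j == y))).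

(** Turning counterclockwise from [k] to the downward vertical crosses exactly the darts with a
    larger key. *)
Lemma left_sideE k : left_side k = side_base (X k) (Y k) (+)
  xsum z (fun j => same_origin j k && (dart_key k < dart_key j)%O).
Proof.
rewrite /left_side /side_base -addbA -xsumD.
have [rk|lk] := boolP (rightward k).
  rewrite near_left_origin //; congr addb; apply: eq_xsum => j.
  rewrite dart_keyE rk -/(same_origin j k) andbC andbAC.
  by case: (rightward j); case: (same_origin j k); rewrite ?addbF.
have rk : rightward (rev k) by rewrite rightward_rev.
rewrite near_left_right // near_right_end // revK over_left_right -addbA.
congr addb; rewrite -[z k](xsum1 z) slope_rev.
rewrite -[X in X (+) _](xsum_rev _ revK z_rev) -xsumD; apply: eq_xsum => j /=.
rewrite !revK slope_rev rightward_rev dart_keyE (negPf lk) -/(same_origin j k).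
have [->|jk] := eqVneq j k.
  by rewrite lk /same_origin !eqxx ltxx.
have [rj|lj] := boolP (rightward j); rewrite /= ?andbF // addbF.
have [sjk|//] := boolP (same_origin j k).
have [//|//|es] := ltgtP (slope j) (slope k).
case/negP: jk; apply/eqP/dart_key_inj => //.
by rewrite /dart_key es (negPf lk) (negPf lj).
Qed.

End Sweep.

(** * Counting faces *)

Lemma xsum_addz (K : finType) (z z' : K -> bool) (P : pred K) :
  xsum (fun k => z k (+) z' k) P = xsum z P (+) xsum z' P.
Proof. by rewrite -big_split; apply: eq_bigr => k _; rewrite andb_addr. Qed.

Lemma next_neq (T : eqType) (s : seq T) (x : T) :
  uniq s -> x \in s -> 1 < size s -> next s x != x.
Proof.
move=> us xs; have [i s' def_s] := rot_to xs.
rewrite -(next_rot i us) -(size_rot i); move: us; rewrite -(rot_uniq i) def_s.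
case: s' {def_s} => //= y s' /andP[xs' _] _; rewrite eqxx.
by apply: contraNneq xs' => ->; rewrite inE eqxx.
Qed.

(** * Darts and the rotation at a vertex *)

Section Faces.
Variable G : sgraph.

Definition dart : finType := {p : G * G | adj p.1 p.2}.
Definition tail (d : dart) : G := (val d).1.
Definition head (d : dart) : G := (val d).2.

Fact dflip_proof (d : dart) : adj (head d) (tail d).
Proof. by rewrite adj_sym; apply: valP d. Qed.
Definition dflip (d : dart) : dart :=
  exist (fun p : G * G => adj p.1 p.2) (head d, tail d) (dflip_proof d).

Lemma dflipK : involutive dflip.
Proof. by move=> d; apply: val_inj; rewrite /= -surjective_pairing. Qed.

Lemma dart_eq d d' : tail d = tail d' -> head d = head d' -> d = d'.
Proof.
rewrite /tail /head => et eh; apply: val_inj.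
by rewrite (surjective_pairing (val d)) et eh -surjective_pairing.
Qed.

Variables (disp : Order.disp_t) (O : orderType disp) (key : dart -> O).
Hypothesis key_inj : forall d d', tail d = tail d' -> key d = key d' -> d = d'.

Definition star (v : G) : seq dart :=
  sort (fun d d' => key d <= key d')%O [seq d <- enum dart | tail d == v].

Lemma mem_star v d : (d \in star v) = (tail d == v).
Proof. by rewrite mem_sort mem_filter mem_enum andbT. Qed.

Lemma star_uniq v : uniq (star v).
Proof. by rewrite sort_uniq filter_uniq ?enum_uniq. Qed.

Lemma star_sorted v : pairwise (relpre key <%O) (star v).
Proof.
have lt_tr : transitive (relpre key <%O) by move=> ? ? ? /=; apply: lt_trans.
rewrite -(sorted_pairwise lt_tr) -sorted_map lt_sorted_uniq_le sorted_map.
rewrite map_inj_in_uniq ?star_uniq.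
  by apply: sort_sorted => d d'; apply: le_total.
move=> d d'; rewrite !mem_star => /eqP dv /eqP d'v.
by apply: key_inj; rewrite dv.
Qed.

Lemma sum_after (z : dart -> bool) s1 d s2 :
  pairwise (relpre key <%O) (s1 ++ d :: s2) ->
  \big[addb/false]_(x <- s1 ++ d :: s2 | (key d < key x)%O) z x
    = \big[addb/false]_(x <- s2) z x.
Proof.
rewrite pairwise_cat => /and3P[/allrelP s1_lt _ /=/andP[/allP s2_gt _]].
rewrite big_cat big_cons /= ltxx big1_seq ?addFb.
  by rewrite big_mkcond; apply: eq_big_seq => x /s2_gt /= ->.
move=> x /andP[dx xs1]; have := s1_lt x d xs1 (mem_head _ _).
by rewrite /= lt_gtF.
Qed.

Definition rotation (d : dart) : dart := next (star (tail d)) d.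

Lemma tail_rotation d : tail (rotation d) = tail d.
Proof. by apply/eqP; rewrite -mem_star mem_next mem_star. Qed.

Lemma rotation_inj : injective rotation.
Proof.
move=> d d' e.
have et : tail d = tail d' by rewrite -tail_rotation e tail_rotation.
move: e; rewrite /rotation et => /(can_inj (prev_next (star_uniq _))).
exact.
Qed.

Section Sides.
Variables (z : dart -> bool) (side : dart -> bool) (base : G -> bool).
Hypothesis z_even : forall v, xsum z (fun d => tail d == v) = false.
Hypothesis sideE : forall d, side d =
  base (tail d) (+)
  xsum z (fun d' => (tail d' == tail d) && (key d < key d')%O).

(** Between consecutive darts the sums differ by one term; from the last dart back to the first,
    evenness of [z] at the vertex closes the cycle. *)
Lemma side_rotation d : side d = side (rotation d) (+) z (rotation d).
Proof.
pose v := tail d; rewrite !sideE tail_rotation -addbA -/v; congr addb.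
have sumE P : xsum z (fun d' => (tail d' == v) && P d')
            = \big[addb/false]_(d' <- star v | P d') z d'.
  rewrite (perm_big _ (permEl (perm_sort _ _))) /= big_filter_cond.
  by rewrite big_enum_cond big_mkcond.
have all0 : \big[addb/false]_(d' <- star v) z d' = false.
  by rewrite -sumE -[RHS](z_even v); apply: eq_xsum => d'; rewrite andbT.
rewrite !sumE /rotation -/v; move: (star_sorted v) (star_uniq v) all0.
have : d \in star v by rewrite mem_star.
case/splitPr=> s1 s2 lt_s uniq_s; rewrite -(next_rot (size s1)) // rot_size_cat.
case: s2 => [|e s2] in lt_s uniq_s *; last first.
  move=> _; rewrite /= eqxx sum_after // -cat_rcons sum_after ?cat_rcons //.
  by rewrite big_cons addbC.
case: s1 => [|e s1] in lt_s uniq_s *.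
  rewrite /= eqxx big_seq1 => zd0.
  by rewrite zd0 addbF.
rewrite /= eqxx => all0; rewrite -cat_cons sum_after // -[e :: s1]cat0s -catA.
rewrite sum_after // big_nil addbC; move: all0; rewrite big_cons => all0.
exact: esym.
Qed.

End Sides.

(** * Face boundaries and the Euler inequality *)

Variable c : G -> bool.
Hypothesis c_proper : forall u v : G, adj u v -> c u != c v.
Hypothesis min_degree : forall v : G, 1 < #|[set w | adj v w]|.
(** Besides the angular order [key], this is all that the face count takes from geometry;
    [drawing_sides] supplies it. *)
Hypothesis sides_exist : forall z : dart -> bool,
  (forall d, z (dflip d) = z d) ->
  (forall v, xsum z (fun d => tail d == v) = false) ->
  exists (side : dart -> bool) (base : G -> bool),
    (forall d, side (dflip d) = side d (+) z d) /\
    (forall d, side d = base (tail d) (+)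
       xsum z (fun d' => (tail d' == tail d) && (key d < key d')%O)).

(* The orbits of this permutation are the face boundaries. *)
Definition face_step (d : dart) : dart := dflip (rotation d).

Lemma face_step_inj : injective face_step.
Proof. by move=> d d' /(can_inj dflipK)/rotation_inj. Qed.

Lemma rotation_neq d : rotation d != d.
Proof.
apply: next_neq; rewrite ?star_uniq ?mem_star //.
apply: leq_trans (min_degree (tail d)) _.
rewrite -(size_map head) cardE uniq_leq_size ?enum_uniq // => w.
rewrite mem_enum inE => vw; apply/mapP.
by exists (exist (fun p : G * G => adj p.1 p.2) (tail d, w) vw);
  rewrite ?mem_star.
Qed.

Lemma c_face_step d : c (tail (face_step d)) = ~~ c (tail d).
Proof.
have := c_proper (valP (rotation d)); rewrite -/(tail _) tail_rotation.
by rewrite /face_step /tail /= -/(head _); case: (c _) (c _) => -[].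
Qed.

(** Each step changes the color class, which excludes odd lengths; length 2 would make [d] a fixed
    point of the rotation, against minimum degree 2. *)
Lemma face_length d : 3 < order face_step d.
Proof.
have := iter_order face_step_inj d; have := order_gt0 face_step d.
case: (order _ _) => [|[|[|[|//]]]] //= _ e; exfalso.
- by have := c_face_step d; rewrite e; case: (c _).
- case/eqP: (rotation_neq d); apply: dart_eq; first exact: tail_rotation.
  have := congr1 head e; rewrite /head /= -/(tail _) => <-.
  by rewrite /face_step tail_rotation.
- have := c_face_step (face_step (face_step d)).
  by rewrite e !c_face_step negbK; case: (c _).
Qed.

Definition faces : {set dart} := [set d | froots face_step d].

Lemma card_faces : 4 * #|faces| <= #|dart|.
Proof.
have fsym := fconnect_sym face_step_inj.
rewrite -[#|dart|]sum1_card (partition_big (froot face_step) (mem faces)).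
  rewrite mulnC -sum_nat_const; apply: leq_sum => d; rewrite inE => /eqP rd.
  rewrite sum1_card; apply: leq_trans (face_length d) (subset_leq_card _).
  apply/subsetP=> d' dd'.
  have : froot face_step d' == froot face_step d.
    by rewrite root_connect // fsym.
  by rewrite rd.
by move=> d _; rewrite !inE; exact: (roots_root fsym).
Qed.

Definition out_darts : {set dart} := [set d | c (tail d)].

Lemma card_dart : #|dart| = 2 * #|out_darts|.
Proof.
rewrite -(cardsC out_darts) mul2n -addnn; congr addn.
rewrite -[RHS](card_imset _ (can_inj dflipK)) (can2_imset_pre _ dflipK dflipK).
apply: eq_card => d; rewrite !inE; have := c_proper (valP d).
by rewrite /tail /= -/(tail d) -/(head d); case: (c _) (c _) => -[].
Qed.

(** An edge set is stored through its darts leaving the true class, and read here on both darts of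
    each edge. *)
Definition edge_fun (x : {set dart}) (d : dart) : bool :=
  (if c (tail d) then d else dflip d) \in x.

Lemma edge_fun_flip x d : edge_fun x (dflip d) = edge_fun x d.
Proof.
rewrite /edge_fun dflipK; have := c_proper (valP d).
by rewrite /tail /= -/(tail d) -/(head d); case: (c _) (c _) => -[].
Qed.

Definition degree_parity x : {ffun G -> bool} :=
  [ffun v => xsum (edge_fun x) (fun d => tail d == v)].

Definition is_side (z : dart -> bool) (s : {ffun dart -> bool}) :=
  [forall d, s (dflip d) == s d (+) z d] && [forall d, s (face_step d) == s d].

(** Flipping [rotation d] undoes the change of side made by the rotation, so sides are constant
    along face boundaries. *)
Lemma is_side_exists z : (forall d, z (dflip d) = z d) ->
  (forall v, xsum z (fun d => tail d == v) = false) ->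
  exists s, is_side z s.
Proof.
move=> zflip z_even; have [s [base [s_flip sE]]] := sides_exist zflip z_even.
exists [ffun d => s d]; apply/andP; split; apply/forallP=> d; rewrite !ffunE.
  by rewrite s_flip.
by rewrite s_flip -(side_rotation z_even sE).
Qed.

(** A side function is determined by one value per face, and [z] is its jump across edges. *)
Lemma is_side_eq z z' s s' : is_side z s -> is_side z' s' ->
  {in faces, s =1 s'} -> z =1 z'.
Proof.
move=> /andP[/forallP zs /forallP stepS].
move=> /andP[/forallP zs' /forallP stepS'] ss'.
have eqs d : s d = s' d.
  have := connect_root (frel face_step) d; set r := froot face_step d => dr.
  have fsym := fconnect_sym face_step_inj.
  have inv (t : {ffun dart -> bool}) : (forall d, t (face_step d) == t d) ->
      t d = t r.
    move=> tE; have /iter_findex <- := dr.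
    by elim: (findex _ _ _) => //= n ->; rewrite (eqP (tE _)).
  by rewrite (inv s) // (inv s') // ss' // inE; exact: (roots_root fsym).
move=> d; apply: (@addbI (s d)).
by rewrite -(eqP (zs d)) eqs (eqP (zs' d)) -eqs.
Qed.

(* An even edge set is determined by the parities with which its drawing
   surrounds the faces; hence E - V <= F. *)
Lemma euler_bound : #|out_darts| <= #|G| + #|faces|.
Proof.
(* [rep y] is a fixed edge set with degree parities [y], if there is one; adding it to a set with
   the same parities makes that set even. *)
pose rep y := odflt set0 [pick x | degree_parity x == y].
pose even_part x d := edge_fun x d (+) edge_fun (rep (degree_parity x)) d.
pose side x : {ffun dart -> bool} :=
  odflt [ffun=> false] [pick s | is_side (even_part x) s].
have sideP x : is_side (even_part x) (side x).
  rewrite /side; case: pickP => // no_side.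
  have [||s] := @is_side_exists (even_part x).
  - by move=> d; rewrite /even_part !edge_fun_flip.
  - move=> v; rewrite xsum_addz /rep; case: pickP => /= [x' /eqP/ffunP/(_ v)|].
      by rewrite !ffunE => ->; rewrite addbb.
    by move/(_ x); rewrite eqxx.
  by rewrite no_side.
(* The parities take at most 2^V values and the sets of faces 2^F, so injectivity gives 2^E <= 2^(V
   + F). *)
pose code x := (degree_parity x, [set r in faces | side x r]).
have code_inj : {in powerset out_darts &, injective code}.
  move=> x x'; rewrite !inE => /subsetP xE /subsetP x'E [eqdeg /setP eqside].
  have eqz : even_part x =1 even_part x'.
    apply: is_side_eq (sideP x) (sideP x') _ => r rF.
    by have := eqside r; rewrite !inE; rewrite inE in rF; rewrite rF.
  apply/setP=> d; have := eqz d; rewrite /even_part eqdeg => /addIb.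
  rewrite /edge_fun; case: ifP => // ncd _; apply/idP/idP.
    by move/xE; rewrite inE ncd.
  by move/x'E; rewrite inE ncd.
rewrite -(leq_exp2l (m := 2)) // -card_powerset -(card_in_imset code_inj).
have -> : 2 ^ (#|G| + #|faces|) =
          #|setX [set: {ffun G -> bool}] (powerset faces)|.
  by rewrite cardsX cardsT card_ffun card_bool card_powerset expnD.
apply/subset_leq_card/subsetP=> _ /imsetP[x _ ->]; rewrite !inE /=.
by apply/subsetP=> r; rewrite inE => /andP[].
Qed.

Lemma bipartite_edge_bound : #|out_darts| <= 2 * #|G|.
Proof. by have := euler_bound; have := card_faces; rewrite card_dart; lia. Qed.

End Faces.

(** * From polygonal to straight line drawings *)

Section Shear.
Local Open Scope ring_scope.
Variable R : realType.
Implicit Types (p q : 'rV[R]_2).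

(** Abscissa after a shear, chosen so that no segment is vertical. *)
Definition xco (t : R) p : R := p 0 0 + t * p 0 1.
Definition yco p : R := p 0 1.

Lemma co_inj t p q : xco t p = xco t q -> yco p = yco q -> p = q.
Proof.
rewrite /xco /yco => ex ey; apply/rowP=> i.
have [->|->] : i = 0 \/ i = 1; last by [].
  by case: i => [[|[|//]] ?]; [left | right]; apply: val_inj.
by move: ex; rewrite ey => /addIr.
Qed.

Lemma shear_exists (K : finType) (p q : K -> 'rV[R]_2) :
  (forall k, p k != q k) -> exists t, forall k, xco t (p k) != xco t (q k).
Proof.
(* The only bad shear for a pair with distinct ordinates is [- r k]; with equal ordinates none is
   bad. A [t] above every |r k| thus works. *)
move=> pq; pose r k := (p k 0 0 - q k 0 0) / (p k 0 1 - q k 0 1).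
exists (1 + \sum_k `|r k|) => k; apply/eqP=> e.
have lt_r : `|r k| < 1 + \sum_k `|r k|.
  rewrite (bigD1 k) //= addrCA ltrDl ltr_pwDl // sumr_ge0 //.
set t := 1 + _ in e lt_r.
have [dy0|dy] := eqVneq (p k 0 1 - q k 0 1) 0.
  case/eqP: (pq k); apply: (@co_inj t) => //.
  by apply/eqP; rewrite -subr_eq0; apply/eqP.
have rE : r k = - t.
  apply: (mulIf dy); rewrite /r divfK //.
  by move: e; rewrite /xco; lra.
by move: lt_r; rewrite rE normrN ltNge ler_norm.
Qed.

Lemma on_segment_line t p q x y : xco t p < xco t q ->
  xco t p <= x <= xco t q ->
  y = yco p + (x - xco t p) * ((yco q - yco p) / (xco t q - xco t p)) ->
  exists P, [/\ on_segment p q P, xco t P = x & yco P = y].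
Proof.
move=> lt_pq /andP[px xq] ->.
have d : 0 < xco t q - xco t p by rewrite subr_gt0.
pose l := (x - xco t p) / (xco t q - xco t p).
exists ((1 - l) *: p + l *: q); split.
- exists l => //; rewrite /l divr_ge0 ?ler_pdivrMr ?mul1r ?subr_ge0 ?lerD2r //.
  exact: ltW.
- have lE : l * (xco t q - xco t p) = x - xco t p by rewrite divfK ?gt_eqF.
  by move: lE; rewrite /xco !mxE; lra.
- by rewrite /yco /l !mxE; move: d => /gt_eqF/negbT d; field.
Qed.

Lemma on_segment_sym p q x : on_segment p q x -> on_segment q p x.
Proof.
case=> t /andP[t0 t1] ->; exists (1 - t); first by apply/andP; split; lra.
by rewrite subKr addrC.
Qed.

Lemma on_segment_l p q : on_segment p q p.
Proof. by exists 0; rewrite ?lexx ?ler01 // subr0 scale1r scale0r addr0. Qed.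

Lemma on_segment_r p q : on_segment p q q.
Proof. exact/on_segment_sym/on_segment_l. Qed.

End Shear.

(** * The segments of a drawing *)

Section SegmentDarts.
Local Open Scope ring_scope.
Variables (R : realType) (G : sgraph) (dr : drawing R G).
Implicit Types (u v : G).

Local Notation arcs u v := (arc dr u v).

(** A common bound on segment indices, which makes the segments a finite type. *)
Definition max_size := (\max_(p : G * G) size (arcs p.1 p.2))%N.

Definition is_segdart (x : G * G * 'I_max_size.+1) :=
  adj x.1.1 x.1.2 && (x.2.+1 < size (arcs x.1.1 x.1.2))%N.

(* The triple (u, v, i) is the i-th segment of the arc from u to v, directed
   along this arc. *)
Definition segdart : finType := {x | is_segdart x}.
Implicit Types (j k : segdart).

Definition from k : G := (val k).1.1.
Definition to k : G := (val k).1.2.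
Definition idx k : nat := (val k).2.
Definition line_of k : seq 'rV[R]_2 := arcs (from k) (to k).
Definition origin k : 'rV[R]_2 := (line_of k)`_(idx k).

Lemma segdart_adj k : adj (from k) (to k).
Proof. by case/andP: (valP k). Qed.

Lemma idx_lt k : ((idx k).+1 < size (line_of k))%N.
Proof. by case/andP: (valP k). Qed.

Lemma segdart_eq j k : from j = from k -> to j = to k -> idx j = idx k -> j = k.
Proof.
case: j k => [[[u v] i] p] [[[u' v'] i'] p'].
rewrite /from /to /idx /= => e1 e2 e3.
by apply: val_inj; rewrite /= e1 e2; congr (_, _); apply: val_inj.
Qed.

Lemma mk_segdart u v (i : nat) k0 : adj u v -> (i.+1 < size (arcs u v))%N ->
  let k := insubd k0 (u, v, inord i) in [/\ from k = u, to k = v & idx k = i].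
Proof.
move=> uv lt_i k; have le_M : (size (arcs u v) <= max_size)%N.
  exact: (@leq_bigmax _ (fun p => size (arcs p.1 p.2)) (u, v)).
have iE : (inord i : 'I_max_size.+1) = i :> nat by rewrite inordK; lia.
by rewrite /from /to /idx /k insubdK ?unfold_in /= ?iE //; apply/andP.
Qed.

(** Segment i joins corners i and i+1; after reversal of an arc with n corners its index is n -
    (i+2). The default of [insubd] is never reached. *)
Definition flip k : segdart :=
  insubd k (to k, from k, inord (size (line_of k) - (idx k).+2)).

Lemma flipE k :
  [/\ from (flip k) = to k, to (flip k) = from k
    & idx (flip k) = (size (line_of k) - (idx k).+2)%N].
Proof.
apply: mk_segdart; first by rewrite adj_sym segdart_adj.
rewrite (arc_rev dr (segdart_adj k)) size_rev -/(line_of k).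
by have := idx_lt k; lia.
Qed.

Lemma line_of_flip k : line_of (flip k) = rev (line_of k).
Proof.
by have [f t _] := flipE k; rewrite /line_of f t (arc_rev dr (segdart_adj k)).
Qed.

Lemma flipK : involutive flip.
Proof.
move=> k; have [f t i] := flipE k; have [f' t' i'] := flipE (flip k).
apply: segdart_eq; rewrite ?f' ?t' // i' line_of_flip size_rev i.
by have := idx_lt k; lia.
Qed.

Lemma nth_rev_line k (i : nat) : (i < size (line_of k))%N ->
  (rev (line_of k))`_i = (line_of k)`_(size (line_of k) - i.+1).
Proof. exact: nth_rev. Qed.

Lemma nth_line_eq k (i i' : nat) :
  (i < size (line_of k))%N -> (i' < size (line_of k))%N ->
  (line_of k)`_i = (line_of k)`_i' -> i = i'.
Proof.
move=> lt_i lt_i' /eqP; rewrite nth_uniq // => [/eqP//|].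
by case: (arcP dr (segdart_adj k)).
Qed.

Lemma origin_flip k : origin (flip k) = (line_of k)`_(idx k).+1.
Proof.
have [_ _ i] := flipE k; have lt_k := idx_lt k.
rewrite /origin line_of_flip i nth_rev_line; last by lia.
by congr nth; lia.
Qed.

Definition step_back k : segdart := insubd k (from k, to k, inord (idx k).-1).

Lemma step_backE k :
  [/\ from (step_back k) = from k, to (step_back k) = to k
    & idx (step_back k) = (idx k).-1].
Proof.
apply: mk_segdart; first exact: segdart_adj.
by have := idx_lt k; rewrite -/(line_of k); lia.
Qed.

Fact first_proof (d : dart G) : is_segdart (tail d, head d, ord0).
Proof.
apply/andP; split; first exact: (valP d).
by case: (arcP dr (valP d)).
Qed.
Definition first (d : dart G) : segdart :=
  exist is_segdart (tail d, head d, ord0) (first_proof d).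

Definition edge_of k : dart G :=
  exist (fun p : G * G => adj p.1 p.2) (from k, to k) (segdart_adj k).

Lemma edge_of_first d : edge_of (first d) = d.
Proof. by apply: dart_eq. Qed.

Lemma first_edge_of k : idx k = 0%N -> first (edge_of k) = k.
Proof. by move=> k0; apply: segdart_eq. Qed.

Lemma edge_of_flip k : edge_of (flip k) = dflip (edge_of k).
Proof.
by have [f t _] := flipE k; apply: dart_eq; rewrite /tail /head /= ?f ?t.
Qed.

Lemma line_of_head k : (line_of k)`_0 = pos dr (from k).
Proof. by rewrite nth0; case: (arcP dr (segdart_adj k)). Qed.

Lemma line_of_last k : (line_of k)`_(size (line_of k)).-1 = pos dr (to k).
Proof. by rewrite nth_last; case: (arcP dr (segdart_adj k)). Qed.

Definition on_segdart k := on_segment (origin k) (origin (flip k)).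

Lemma on_segdart_flip k x : on_segdart (flip k) x -> on_segdart k x.
Proof. by rewrite /on_segdart flipK; apply: on_segment_sym. Qed.

Lemma on_segdart_polyline k x : on_segdart k x -> on_polyline (line_of k) x.
Proof. by rewrite /on_segdart origin_flip; exists (idx k); rewrite ?idx_lt. Qed.

Lemma same_line_meet j k x : from j = from k -> to j = to k -> j != k ->
  on_segdart j x -> on_segdart k x -> x = origin j \/ x = origin (flip j).
Proof.
move=> ef et jk; rewrite /on_segdart !origin_flip /origin.
have el : line_of j = line_of k by rewrite /line_of ef et.
have [_ _ _ _ simple] := arcP dr (segdart_adj j).
rewrite -/(line_of j) in simple; rewrite -el => onj onk.
have := idx_lt j; have := idx_lt k; rewrite -el => ltk ltj.
have [jk_lt|jk_gt|e] := ltngtP (idx j) (idx k).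
- by have [<- ->] := simple _ _ _ jk_lt ltk onj onk; right.
- by have [_ ->] := simple _ _ _ jk_gt ltj onk onj; left.
- by case/eqP: jk; apply: segdart_eq.
Qed.

(** An end of the arc also lies on its first or last segment, so simplicity of the arc makes it a
    corner. *)
Lemma on_segdart_vertex k x : on_segdart k x ->
  x = pos dr (from k) \/ x = pos dr (to k) ->
  x = origin k \/ x = origin (flip k).
Proof.
have [_ _ _ _ simple] := arcP dr (segdart_adj k).
rewrite -/(line_of k) in simple; have lt_k := idx_lt k.
rewrite /on_segdart origin_flip /origin => on_x [xE|xE].
  have [i0|i_gt0] := posnP (idx k); first by left; rewrite i0 line_of_head.
  have on0 : on_segment (line_of k)`_0 (line_of k)`_1 x.
    by rewrite line_of_head -xE; apply: on_segment_l.
  by have [_ ->] := simple _ _ _ i_gt0 lt_k on0 on_x; left.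
right; pose n := (size (line_of k)).-2.
have [->|lt_n] : idx k = n \/ (idx k < n)%N by rewrite /n; lia.
  by rewrite xE -line_of_last; congr nth; rewrite /n; lia.
have n2 : (n.+1 < size (line_of k))%N by rewrite /n; lia.
have onn : on_segment (line_of k)`_n (line_of k)`_n.+1 x.
  have -> : n.+1 = (size (line_of k)).-1 by rewrite /n; lia.
  by rewrite line_of_last -xE; apply: on_segment_r.
by have [<- ->] := simple _ _ _ lt_n n2 on_x onn.
Qed.

Lemma set2_eq u v u' v' : u != v -> [set u; v] = [set u'; v'] ->
  (u = u' /\ v = v') \/ (u = v' /\ v = u').
Proof.
move=> uv e; have := set21 u v; have := set22 u v; rewrite e.
move=> /set2P[]vE /set2P[]uE; move: uv; rewrite vE uE ?eqxx // => _.
  by right.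
by left.
Qed.

Lemma adj_neq u v : adj u v -> u != v.
Proof. by apply: contraTneq => ->; rewrite adj_irrefl. Qed.

(** Within one edge this is simplicity of the arc; arcs of distinct edges meet only at vertices. *)
Lemma segdart_meet j k x : j != k -> j != flip k ->
  on_segdart j x -> on_segdart k x -> x = origin j \/ x = origin (flip j).
Proof.
move=> jk jfk onj onk; have adj_j := segdart_adj j.
have [/(set2_eq (adj_neq adj_j))[[ef et]|[ef et]]|ne] :=
    eqVneq [set from j; to j] [set from k; to k].
- exact: same_line_meet onj onk.
- have [f t _] := flipE k.
  apply: (@same_line_meet j (flip k)); rewrite ?f ?t //.
  by apply: on_segdart_flip; rewrite flipK.
- apply: (on_segdart_vertex onj).
  exact: (arc_disjoint adj_j (segdart_adj k) ne (on_segdart_polyline onj)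
    (on_segdart_polyline onk)).
Qed.

Lemma origin_neq k : origin (flip k) != origin k.
Proof.
have lt_k := idx_lt k; rewrite origin_flip; apply/eqP=> /nth_line_eq; lia.
Qed.

(** The other dart starting at the origin of [k], when this is an inner corner of the arc. *)
Definition turn_back k : segdart := flip (step_back k).

Lemma origin_turn_back k : (0 < idx k)%N -> origin (turn_back k) = origin k.
Proof.
have [f t i] := step_backE k.
by rewrite origin_flip /origin i /line_of f t => /prednK->.
Qed.

Lemma turn_back_neq k : turn_back k != k.
Proof.
have [f t _] := step_backE k; have [f' t' _] := flipE (step_back k).
have := adj_neq (segdart_adj k); apply: contraNneq => e.
by rewrite -{1}e /turn_back f' t.
Qed.

Lemma origin_index0 k : origin k = pos dr (from k) -> idx k = 0%N.
Proof.
by have lt_k := idx_lt k; rewrite -line_of_head => /nth_line_eq; apply; lia.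
Qed.

Lemma origin_not_last k : origin k != pos dr (to k).
Proof.
by have lt_k := idx_lt k; rewrite -line_of_last; apply/eqP=> /nth_line_eq; lia.
Qed.

(** Corners of an arc are distinct, arcs of distinct edges meet only at vertices, and no dart starts
    at the last corner of its arc. *)
Lemma origin_eq j k : origin j = origin k ->
  [\/ [/\ idx j = 0%N, idx k = 0%N & from j = from k], j = k
    | (0 < idx k)%N /\ j = turn_back k].
Proof.
move=> e; have adj_j := segdart_adj j.
have lt_j := idx_lt j; have lt_k := idx_lt k.
have [/(set2_eq (adj_neq adj_j))[[ef et]|[ef et]]|ne] :=
    eqVneq [set from j; to j] [set from k; to k].
- apply: Or32; apply: segdart_eq => //.
  have el : line_of j = line_of k by rewrite /line_of ef et.
  move: e lt_j; rewrite /origin el => e lt_j.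
  by apply: (nth_line_eq _ _ e); lia.
- apply: Or33; have el : line_of j = rev (line_of k).
    by rewrite /line_of ef et (arc_rev dr (segdart_adj k)).
  have lt_j' : ((idx j).+1 < size (line_of k))%N by rewrite -size_rev -el.
  have ik : (size (line_of k) - (idx j).+1)%N = idx k.
    apply: (@nth_line_eq k); [lia | lia | rewrite -nth_rev_line; last by lia].
    by rewrite -el.
  have [f t i] := step_backE k; have [f' t' i'] := flipE (step_back k).
  split; first by lia.
  have elb : line_of (step_back k) = line_of k by rewrite /line_of f t.
  by apply: segdart_eq; rewrite /turn_back ?f' ?t' ?i' ?f ?t // i elb; lia.
- have onj : on_segdart j (origin j) by apply: on_segment_l.
  have onk : on_segdart k (origin j) by rewrite e; apply: on_segment_l.
  have polyj := on_segdart_polyline onj; have polyk := on_segdart_polyline onk.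
  have [oj|oj] := arc_disjoint adj_j (segdart_adj k) ne polyj polyk; last first.
    by have := origin_not_last j; rewrite oj eqxx.
  rewrite eq_sym in ne.
  have [ok|ok] := arc_disjoint (segdart_adj k) adj_j ne polyk polyj; last first.
    by have := origin_not_last k; rewrite -e ok eqxx.
  apply: Or31; split; first exact: origin_index0.
    by apply: origin_index0; rewrite -e.
  by apply: (pos_inj (d := dr)); rewrite -oj.
Qed.

End SegmentDarts.

(** * Sides of even edge sets in a planar drawing *)

Section PlanarSides.
Local Open Scope ring_scope.
Variables (R : realType) (G : sgraph) (dr : drawing R G) (t : R).
Let K := segdart dr.
Let X (k : K) := xco t (origin k).
Let Y (k : K) := yco (origin k).
Let rev : K -> K := @flip R G dr.
Hypothesis X_flip : forall k : K, X (rev k) != X k.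

Lemma drawing_noncrossing (j k : K) x :
  rightward rev X j -> rightward rev X k -> j != k ->
  spans rev X j x -> spans rev X k x -> line rev X Y j x = line rev X Y k x ->
  x = X j \/ x = X (rev j).
Proof.
move=> rj rk jk sj sk e.
have [P [onj Px Py]] := on_segment_line rj sj (erefl (line rev X Y j x)).
have [Q [onk Qx Qy]] := on_segment_line rk sk (erefl (line rev X Y k x)).
have PQ : Q = P by apply: (@co_inj _ t); rewrite ?Px ?Py // Qy -e.
rewrite {}PQ in onk; rewrite -Px.
have [||->|->] := @segdart_meet R G dr j k P _ _ onj onk; auto.
apply: contraTneq rj => ->.
by rewrite (rightward_rev (@flipK R G dr) X_flip) rk.
Qed.

Lemma same_originE (j k : K) :
  same_origin X Y j k = (origin j == origin k).
Proof.
apply/andP/eqP=> [[/eqP ex /eqP ey]|e]; first exact: co_inj ex ey.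
by rewrite /X /Y e.
Qed.

Section EvenSet.
Variable z : dart G -> bool.
Hypothesis z_flip : forall d, z (dflip d) = z d.
Hypothesis z_even : forall v, xsum z (fun d => tail d == v) = false.

Definition lift_set (k : K) := z (edge_of k).

Lemma lift_set_flip k : lift_set (rev k) = lift_set k.
Proof. by rewrite /lift_set edge_of_flip. Qed.

(** Darts of the graph correspond to segment darts of index 0. *)
Lemma xsum_first (P : pred (dart G)) :
  xsum lift_set (fun k => (idx k == 0%N) && P (edge_of k)) = xsum z P.
Proof.
rewrite /xsum (eq_bigr (fun k => if idx k == 0%N
    then P (edge_of k) && z (edge_of k) else false)); last first.
  by move=> k _; case: eqP.
rewrite -big_mkcond (reindex_onto (first dr) (@edge_of R G dr)) /=; last first.
  by move=> k /eqP; apply: first_edge_of.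
by apply: eq_big => d; rewrite edge_of_first ?eqxx.
Qed.

Lemma same_origin_first (j k : K) : idx k = 0%N ->
  same_origin X Y j k = (idx j == 0%N) && (tail (edge_of j) == from k).
Proof.
have tailE : tail (edge_of j) = from j by [].
move=> k0; rewrite same_originE tailE.
apply/eqP/andP=> [/origin_eq[[-> _ ->]|->|[]]|].
- by rewrite !eqxx.
- by rewrite k0 !eqxx.
- by rewrite k0.
case=> /eqP j0 /eqP ef.
by rewrite /origin j0 k0 !line_of_head ef.
Qed.

Lemma xsum_inner (k : K) (P : pred K) : (0 < idx k)%N ->
  xsum lift_set (fun j => same_origin X Y j k && P j)
    = (P k (+) P (turn_back k)) && lift_set k.
Proof.
move=> k_gt0; have back_k : lift_set (turn_back k) = lift_set k.
  rewrite /lift_set /turn_back edge_of_flip z_flip; congr z.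
  by have [f e _] := step_backE k; apply: dart_eq.
have pick1 k' : xsum lift_set (fun j => (j == k') && P j) = P k' && lift_set k'.
  case: (boolP (P k')) => Pk'.
    rewrite -(xsum1 lift_set k'); apply: eq_xsum => j /=.
    by case: eqP => // ->.
  rewrite -[RHS](xsum0 lift_set); apply: eq_xsum => j /=.
  by case: eqP => // ->; apply: negbTE.
rewrite andb_addl -[X in _ (+) (_ && X)]back_k -!pick1 -xsumD.
apply: eq_xsum => j; rewrite -andb_addl; congr andb.
have tk := turn_back_neq k; rewrite same_originE.
have [->|jk] := eqVneq j k; first by rewrite eqxx eq_sym (negPf tk).
have [->|jtk] := eqVneq j (turn_back k).
  by rewrite origin_turn_back ?eqxx.
apply/eqP=> /origin_eq[[_ k0]|ejk|[_ ej]].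
- by rewrite k0 in k_gt0.
- by rewrite ejk eqxx in jk.
- by rewrite ej eqxx in jtk.
Qed.

Lemma lift_set_even k : xsum lift_set ((same_origin X Y)^~ k) = false.
Proof.
have [k0|k_gt0] := posnP (idx k).
  rewrite -[RHS](z_even (from k)) -xsum_first; apply: eq_xsum => j.
  exact: same_origin_first.
rewrite -[RHS]/(false && lift_set k) -(addbb true) -(xsum_inner xpredT k_gt0).
by apply: eq_xsum => j; rewrite andbT.
Qed.

Let side := left_side rev X Y lift_set.
Let key := dart_key rev X Y.

Lemma side_flip k : side (rev k) = side k (+) lift_set k.
Proof. exact: (left_side_rev Y (@flipK R G dr) X_flip lift_set_flip). Qed.

Lemma sideE k : side k = side_base rev X Y lift_set (X k) (Y k) (+)
  xsum lift_set (fun j => same_origin X Y j k && (key k < key j)%O).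
Proof.
exact: (left_sideE (@flipK R G dr) X_flip drawing_noncrossing lift_set_flip
  lift_set_even).
Qed.

Lemma key_inj (j k : K) : same_origin X Y j k -> key j = key k -> j = k.
Proof. exact: (dart_key_inj (@flipK R G dr) X_flip drawing_noncrossing). Qed.

(** Only [k] and [turn_back k] start at an inner corner, and [z] has both or neither. Their sides
    differ by one crossing, which the flip of [step_back k] cancels. *)
Lemma side_step_back k : (0 < idx k)%N -> side (step_back k) = side k.
Proof.
move=> k_gt0; have ob := origin_turn_back k_gt0.
have same_bk : same_origin X Y (turn_back k) k by rewrite same_originE ob.
have back_set : lift_set (step_back k) = lift_set k.
  rewrite /lift_set; congr z.
  by have [f e _] := step_backE k; apply: dart_eq.
have := side_flip (step_back k); rewrite back_set -/(turn_back k).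
have XY : X (turn_back k) = X k /\ Y (turn_back k) = Y k by rewrite /X /Y ob.
have -> : side (turn_back k) = side_base rev X Y lift_set (X k) (Y k) (+)
    xsum lift_set
      (fun j => same_origin X Y j k && (key (turn_back k) < key j)%O).
  rewrite sideE; case: XY => -> ->; congr addb; apply: eq_xsum => j.
  by rewrite !same_originE ob.
rewrite (sideE k) !xsum_inner //= !ltxx addFb addbF.
case: ltgtP => [||/(key_inj same_bk)/eqP]; last first.
  by rewrite (negPf (turn_back_neq k)).
all: by case: (side_base _ _ _ _ _ _) (side _) (lift_set k) => -[] [].
Qed.

Lemma side_first k : side k = side (first dr (edge_of k)).
Proof.
elim: {k}(idx k) {-2}k (erefl (idx k)) => [|n IHn] k kn.
  by rewrite first_edge_of.
have [f e i] := step_backE k; rewrite -side_step_back ?kn // IHn ?i ?kn //.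
by congr (side (first dr _)); apply: dart_eq.
Qed.

Lemma drawing_sides : exists (s : dart G -> bool) (base : G -> bool),
  (forall d, s (dflip d) = s d (+) z d) /\
  (forall d, s d = base (tail d) (+)
     xsum z (fun d' => (tail d' == tail d) &&
                       (key (first dr d) < key (first dr d'))%O)).
Proof.
(* Sides being constant along an arc, the first segment stands for the whole edge. *)
exists (fun d => side (first dr d)).
exists (fun v =>
  side_base rev X Y lift_set (xco t (pos dr v)) (yco (pos dr v))).
split=> d.
  have := side_flip (first dr d); rewrite side_first edge_of_flip edge_of_first.
  by rewrite /lift_set edge_of_first.
rewrite sideE /X /Y; have -> : origin (first dr d) = pos dr (tail d).
  exact: (line_of_head (first dr d)).
congr addb; rewrite -xsum_first; apply: eq_xsum => j.
rewrite same_origin_first // -andbA; case: eqP => //= j0.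
by rewrite first_edge_of.
Qed.

End EvenSet.

End PlanarSides.

Lemma drawing_edge_bound (R : realType) (G : sgraph) (dr : drawing R G)
    (c : G -> bool) :
  (forall u v : G, adj u v -> c u != c v) ->
  (forall v : G, 1 < #|[set w | adj v w]|)%N ->
  (#|out_darts c| <= 2 * #|G|)%N.
Proof.
move=> c_proper min_deg.
have [t X_flip] := shear_exists (@origin_neq R G dr).
pose X (k : segdart dr) := xco t (origin k).
pose Y (k : segdart dr) := yco (origin k).
pose key d := dart_key (@flip R G dr) X Y (first dr d).
apply: (@bipartite_edge_bound G _ _ key _ c c_proper min_deg).
  move=> d d' edd' /(key_inj X_flip) e.
  rewrite -[d](edge_of_first dr) e ?edge_of_first // same_origin_first //.
  by rewrite edge_of_first; apply/andP; split; last exact/eqP.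
move=> z z_flip z_even; exact: drawing_sides.
Qed.

(** * Sparsity of bipartite planar graphs *)

Section Induced.
Variables (G : sgraph) (U : {set G}).

Let induced_adj : rel {x : G | x \in U} := relpre val (@adj G).

Fact induced_sym : symmetric induced_adj.
Proof. by move=> u v; apply: adj_sym. Qed.

Fact induced_irrefl : irreflexive induced_adj.
Proof. by move=> u; apply: adj_irrefl. Qed.

Definition induced : sgraph := SGraph induced_sym induced_irrefl.

Lemma induced_drawing (R : realType) : drawing R G -> drawing R induced.
Proof.
move=> dr; pose f (u : induced) : G := val u.
apply: (@Drawing R induced (fun u => pos dr (f u))
                          (fun u v => arc dr (f u) (f v))).
- by move=> u v /pos_inj/val_inj.
- by move=> u v uv; apply: arc_rev.
- by move=> u v uv; apply: arcP.
- move=> u v w uv on_w.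
  have [/val_inj->|/val_inj->] := arc_vertex (uv : adj (f u) (f v)) on_w.
    by left.
  by right.
- move=> u v u' v' x uv uv' ne; apply: arc_disjoint => //.
  apply: contraNneq ne => e; apply/eqP.
  have /(imset_inj val_inj) // : val @: [set u; v] = val @: [set u'; v'].
  by rewrite !imsetU1 !imset_set1.
Qed.

End Induced.

(** * Edge bound and choosability through orientations *)

Section EdgeCount.
Variables (G : sgraph) (c : G -> bool).
Hypothesis c_proper : forall u v : G, adj u v -> c u != c v.

Definition edges : {set G * G} := [set p | adj p.1 p.2 && c p.1].

Definition toward (u v : G) : G * G := if c u then (u, v) else (v, u).

Lemma toward_edge u v : adj u v -> toward u v \in edges.
Proof.
move=> uv; rewrite /toward !inE; have := c_proper uv.
by case: ifP => [->|_]; rewrite ?uv //= adj_sym uv; case: (c v).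
Qed.

Lemma toward_inj u : injective (toward u).
Proof. by move=> v w; rewrite /toward; case: ifP => _ []. Qed.

(** A vertex with at most two neighbours in [U] is removed by induction; if there is none, the
    induced subgraph has large enough degrees for the face count. *)
Lemma spanned_edge_bound (R : realType) (U : {set G}) :
  drawing R G -> #|spanned edges U| <= 2 * #|U|.
Proof.
move=> dr; have [n] := ubnP #|U|; elim: n U => // n IHn U leU.
have [/exists_inP[v vU deg_v]|big_deg] :=
    boolP [exists v in U, #|[set w in U | adj v w]| <= 2].
  have U'E := cardsD1 v U; rewrite vU in U'E.
  have := IHn (U :\ v); rewrite {}U'E in leU * => /(_ leU) IHv.
  rewrite mulnDr addnC.
  apply: leq_trans (leq_add IHv deg_v).
  rewrite -(card_imset _ (@toward_inj v)).
  apply: leq_trans (leq_card_setU _ _); apply/subset_leq_card/subsetP=> -[p q].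
  rewrite !(in_spanned, inE) /= => /and3P[/andP[pq cp] pU qU].
  rewrite pq cp pU qU !andbT /=.
  have [pv|_] := eqVneq p v.
    apply/orP; right; apply/imsetP; exists q; first by rewrite inE qU -pv.
    by rewrite /toward -pv cp.
  have [qv|_] := eqVneq q v; last by [].
  apply/orP; right; apply/imsetP; exists p; first by rewrite inE pU -qv adj_sym.
  by rewrite /toward -qv; have := c_proper pq; rewrite cp; case: (c q).
have min_deg (v : induced U) : 1 < #|[set w | adj v w]|.
  move: big_deg; rewrite negb_exists => /forallP/(_ (val v)).
  rewrite (valP v) /= -ltnNge => /ltnW/leq_trans; apply.
  rewrite -(card_imset _ val_inj); apply/subset_leq_card/subsetP=> w.
  rewrite inE => /andP[wU vw]; apply/imsetP.
  by exists (exist (fun x : G => x \in U) w wU); rewrite ?inE.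
have c'_proper (u v : induced U) : adj u v -> c (val u) != c (val v).
  exact: c_proper.
have := drawing_edge_bound (induced_drawing U dr) c'_proper min_deg.
rewrite card_sig => bound; apply: leq_trans _ bound.
pose ends (d : dart (induced U)) : G * G := (val (tail d), val (head d)).
apply: leq_trans (leq_imset_card ends _).
apply/subset_leq_card/subsetP=> -[p q].
rewrite !(in_spanned, inE) /= => /and3P[/andP[pq cp] pU qU]; apply/imsetP.
pose p' : induced U := exist _ p pU; pose q' : induced U := exist _ q qU.
by exists (exist (fun p : induced U * induced U => adj p.1 p.2) (p', q') pq);
  rewrite ?inE.
Qed.

Lemma bipartite_planar_choosable (R : realType) a b :
  drawing R G -> 3 * b <= a -> choosable a b G.
Proof.
move=> dr le_ab C L cardL.
have [U|f [fE f_deg]] := @bounded_orientation _ edges (fun=> 2).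
  by rewrite sum_nat_const mulnC; apply: spanned_edge_bound dr.
(* Each edge leaves the end that [f] assigns to it, so at most two edges leave a vertex and b + 2b
   colors suffice. *)
pose out u v := adj u v && (f (toward u v) == u).
have out_deg u : #|[set v | out u v]| <= 2.
  apply: leq_trans (f_deg u); rewrite -(card_imset _ (@toward_inj u)).
  apply/subset_leq_card/subsetP=> _ /imsetP[v + ->].
  by rewrite !inE => /andP[uv ->]; have := toward_edge uv; rewrite inE => ->.
have out_adj u v : adj u v -> out u v || out v u.
  move=> uv; rewrite /out (adj_sym v) uv /= /toward; have := c_proper uv.
  have := fE _ (toward_edge uv); rewrite /toward.
  by case: (c u) (c v) => -[] //= [->|->] _; rewrite eqxx ?orbT.
have [|u b_gt0|phi [phiL phi_b phiD]] :=
    @kernel_multicoloring _ c out C (fun=> b) L.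
- by move=> u v /andP[/c_proper].
- rewrite sum_nat_const cardL; apply: leq_trans le_ab.
  by rewrite (mulSn 2) leq_add2l leq_mul2r -cardsE out_deg orbT.
exists phi; split=> // u v /out_adj/orP[]; first exact: phiD.
by rewrite fsetIC; apply: phiD.
Qed.

End EdgeCount.

(** * The graphs K_(2,n) *)

Section DoubleStar.
Variable T : finType.

Definition double_star_adj : rel (bool + T) := fun x y =>
  match x, y with inl _, inr _ | inr _, inl _ => true | _, _ => false end.

Fact double_star_sym : symmetric double_star_adj.
Proof. by case=> [?|?] []. Qed.

Fact double_star_irrefl : irreflexive double_star_adj.
Proof. by case. Qed.

(* K_(2,n), where n is the cardinal of T. *)
Definition double_star : sgraph := SGraph double_star_sym double_star_irrefl.

Lemma double_star_bipartite : bipartite double_star.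
Proof.
by exists (fun x : bool + T => if x is inl _ then true else false) => -[?|?] [].
Qed.

Section Drawing.
Variable R : realType.
Local Open Scope ring_scope.

Let sgn (e : bool) : R := if e then 1 else -1.
Let abscissa (t : T) : R := (enum_rank t).+1%:R.

(** The two centers lie at heights 1 and -1 on the vertical axis, the leaves on the positive
    horizontal axis. *)
Definition double_star_pos (x : double_star) : 'rV[R]_2 :=
  match x with
  | inl e => \row_i (if i == 0 then 0 else sgn e)
  | inr t => \row_i (if i == 0 then abscissa t else 0)
  end.

Let arc2 (x y : double_star) := [:: double_star_pos x; double_star_pos y].

Let abscissa_gt0 t : 0 < abscissa t.
Proof. exact: ltr0Sn. Qed.

Let abscissa_inj : injective abscissa.
Proof.
by move=> t t' /eqP; rewrite eqr_nat eqSS => /eqP/ord_inj/enum_rank_inj.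
Qed.

Let sgn_neq0 e : sgn e != 0.
Proof. by case: e; rewrite /sgn ?oppr_eq0 oner_eq0. Qed.

Let sgn_inj : injective sgn.
Proof. by move=> [] [] //=; rewrite /sgn => e; lra. Qed.

Let pos_inj : injective double_star_pos.
Proof.
have neq t e : double_star_pos (inr t) <> double_star_pos (inl e).
  move/rowP/(_ 0); rewrite !mxE eqxx => t0.
  by have := abscissa_gt0 t; rewrite t0 ltxx.
move=> [e|t] [e'|t'] //= E.
- by move/rowP/(_ 1): E; rewrite !mxE /= => /sgn_inj->.
- by case: (neq t' e).
- by case: (neq t e').
- by move/rowP/(_ 0): E; rewrite !mxE eqxx => /abscissa_inj->.
Qed.

Let on_arc2 x y P : double_star_adj x y -> on_polyline (arc2 x y) P ->
  exists e t s, [/\ [set x; y] = [set inl e; inr t] :> {set double_star},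
    0 <= s <= 1, P 0 0 = s * abscissa t & P 0 1 = (1 - s) * sgn e].
Proof.
move=> xy [[|//] _ /= [s s01 ->]].
case: x y xy => [e|t] [e'|t'] //= _.
  by exists e, t', s; split; rewrite // !mxE /=; ring.
exists e', t, (1 - s); split; rewrite ?(setUC [set inr t]) // ?mxE /=; try ring.
by move: s01 => /andP[? ?]; apply/andP; split; lra.
Qed.

Lemma double_star_drawing : drawing R double_star.
Proof.
apply: (@Drawing R double_star double_star_pos arc2).
- exact: pos_inj.
- by [].
- move=> u v uv; split=> //=.
  + rewrite inE andbT (inj_eq pos_inj).
    by apply: contraTneq uv => ->; rewrite adj_irrefl.
  + by move=> [|i] [|j].
- move=> u v w uv /(on_arc2 uv)[e [t [s [E s01 P0 P1]]]].
  apply/set2P; rewrite E; case: w P0 P1 => [e'|t'] /=; rewrite !mxE /= => P0 P1.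
    have s0 : s = 0.
      apply/eqP; move/esym/eqP: P0.
      by rewrite mulf_eq0 (gt_eqF (abscissa_gt0 t)) orbF.
    by move: P1; rewrite s0 subr0 mul1r => /sgn_inj->; rewrite set21.
  have s1 : s = 1.
    apply/eqP; move/esym/eqP: P1; rewrite mulf_eq0 (negPf (sgn_neq0 e)) orbF.
    by rewrite subr_eq0 eq_sym.
  by move: P0; rewrite s1 mul1r => /abscissa_inj->; rewrite set22.
- move=> u v u' v' P uv uv' ne /(on_arc2 uv)[e [t [s [E s01 P0 P1]]]].
  move=> /(on_arc2 uv')[e' [t' [s' [E' s01' P0' P1']]]].
  suff [->|->] : P = double_star_pos (inl e) \/ P = double_star_pos (inr t).
  + have /set2P[->|->] : inl e \in [set u; v] by rewrite E set21.
      by left.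
    by right.
  + have /set2P[->|->] : inr t \in [set u; v] by rewrite E set22.
      by left.
    by right.
  rewrite E E' in ne.
  have PE x y : P 0 0 = x -> P 0 1 = y -> P = \row_i (if i == 0 then x else y).
    move=> Px Py; apply/rowP=> i; rewrite mxE.
    case: i => [[|[|//]] ?] /=; [rewrite -Px | rewrite -Py]; congr (P _ _).
      exact: val_inj.
    exact: val_inj.
  (* With a common center, the height determines the parameter, and distinct leaves force the center
     itself. *)
  have [ee|ee] := eqVneq e e'.
    have ss : s = s'.
      move: P1' P1; rewrite ee => -> /(mulIf (sgn_neq0 _)); lra.
    have [tt|tt] := eqVneq t t'; first by rewrite ee tt eqxx in ne.
    have s0 : s = 0.
      apply/eqP; have : s * (abscissa t - abscissa t') = 0.
        by rewrite mulrBr -P0 P0' ss subrr.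
      move/eqP; rewrite mulf_eq0 subr_eq0 (inj_eq abscissa_inj) (negPf tt).
      by rewrite orbF.
    by left; apply: PE; rewrite ?P0 ?P1 s0 ?mul0r // subr0 mul1r.
  (* Edges at different centers lie in opposite closed half planes, so they meet on the horizontal
     axis, at a leaf. *)
  have s1 : s = 1.
    move: P1' P1 s01 s01' => -> + /andP[? ?] /andP[? ?]; rewrite /sgn.
    by case: e e' ee {E E' ne} => -[] // _; lra.
  by right; apply: PE; rewrite ?P0 ?P1 s1 ?mul1r ?subrr ?mul0r.
Qed.

End Drawing.

End DoubleStar.

(** * Lists on K_(2,n) that defeat a < 3b *)

Lemma subset_of_card (T : finType) (A : {set T}) (n : nat) :
  n <= #|A| -> exists2 X : {set T}, X \subset A & #|X| = n.
Proof.
move=> le_n; exists [set x in take n (enum A)].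
  by apply/subsetP=> x; rewrite inE => /mem_take; rewrite mem_enum.
by rewrite cardsE (card_uniqP _) ?take_uniq ?enum_uniq // size_takel -?cardE.
Qed.

(** [X] is taken inside [S] or around it; truncated subtraction covers both cases. *)
Lemma set_of_card_avoiding (T : finType) (S : {set T}) (n : nat) : n <= #|T| ->
  exists X : {set T}, (#|X| == n) && (#|X :\: S| == n - #|S|).
Proof.
move=> le_n; have [le_nS|lt_Sn] := leqP n #|S|.
  have [X XS Xn] := subset_of_card le_nS; exists X; rewrite Xn eqxx /=.
  by move: XS; rewrite -setD_eq0 => /eqP->; rewrite cards0 eq_sym subn_eq0.
have [|Y YS Yn] := @subset_of_card _ (~: S) (n - #|S|).
  by have := cardsC S; lia.
have dYS : [disjoint S & Y] by rewrite disjoint_sym disjoints_subset.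
exists (S :|: Y); rewrite setDUl setDv set0U cardsU.
have -> : S :&: Y = set0 by apply/eqP; rewrite setI_eq0.
have -> : Y :\: S = Y by apply/setDidPl; rewrite disjoint_sym.
by rewrite cards0 Yn eqxx; lia.
Qed.

Section ListOfSet.
Variable C : finType.

Definition fset_of_set (A : {set C}) : {fset C} := [fset x in enum A]%fset.

Lemma in_fset_of_set A x : (x \in fset_of_set A) = (x \in A).
Proof. by rewrite !inE mem_enum. Qed.

Lemma card_fset_of_set A : #|` fset_of_set A| = #|A|.
Proof. by rewrite card_fseq undup_id ?enum_uniq // -cardE. Qed.

Definition set_of_fset (F : {fset C}) : {set C} := [set x | x \in F].

Lemma card_set_of_fset F : #|set_of_fset F| = #|` F|.
Proof.
rewrite -card_fset_of_set; congr (#|` _|); apply/fsetP=> x.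
by rewrite in_fset_of_set inE.
Qed.

End ListOfSet.

(* The two vertices of large degree have disjoint lists, and whichever pair of
   b-sets they receive, some common neighbour has a list containing as much of
   their union as its size allows. *)
Lemma double_star_choosable (a b : nat) : 0 < b ->
  choosable a b (double_star {set 'I_a * bool}) -> 3 * b <= a.
Proof.
move=> b_gt0 chG; pose C := ('I_a * bool)%type : finType.
have ex_list (S : {set C}) := @set_of_card_avoiding _ S a.
have le_aC : a <= #|C| by rewrite card_prod card_ord card_bool; lia.
pose list S : {set C} := xchoose (ex_list S le_aC).
have listP S := xchooseP (ex_list S le_aC).
pose side e : {set C} := [set x | x.2 == e].
have card_side e : #|side e| = a.
  have -> : side e = (fun i => (i, e)) @: [set: 'I_a].
    apply/setP=> -[i e']; rewrite inE /=.
    apply/eqP/imsetP=> [->|[j _ [_ ->]]] //.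
    by exists i; rewrite ?inE.
  by rewrite card_imset ?cardsT ?card_ord // => i j [].
pose L (x : double_star {set C}) : {fset C} :=
  fset_of_set (match x with inl e => side e | inr A => list A end).
have [|phi [phiL phi_b phiD]] := chG C L.
  move=> [e|A]; rewrite card_fset_of_set ?card_side //.
  by case/andP: (listP A) => /eqP.
pose psi x := set_of_fset (phi x).
have psiL x :
    psi x \subset (match x with inl e => side e | inr A => list A end).
  apply/subsetP=> y; rewrite inE => /(fsubsetP (phiL x)).
  by case: x => [e|A]; rewrite in_fset_of_set.
have psiD x y : @adj (double_star {set C}) x y -> [disjoint psi x & psi y].
  move=> xy; apply/pred0P=> w; rewrite /= !inE -in_fsetI phiD //.
have psi_b x : #|psi x| = b by rewrite card_set_of_fset.
pose S := psi (inl true) :|: psi (inl false).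
have card_S : #|S| = 2 * b.
  rewrite cardsU !psi_b; have -> : psi (inl true) :&: psi (inl false) = set0.
    apply/setP=> x; rewrite in_setI in_set0; apply/andP=> -[].
    move=> /(subsetP (psiL _)) + /(subsetP (psiL _)); rewrite !inE.
    by move=> /eqP->.
  by rewrite cards0; lia.
(* The leaf indexed by [S] finds its b colors among the a - 2b of its list outside [S]; b > 0 rules
   out truncation. *)
have : psi (inr S) \subset list S :\: S.
  rewrite subsetD (psiL (inr S)) -setI_eq0 setIUr setU_eq0 !setI_eq0.
  by rewrite !psiD.
move/subset_leq_card; rewrite psi_b.
by case/andP: (listP S) => _ /eqP->; rewrite card_S; lia.
Qed.

Local Open Scope ring_scope.

Theorem theorem2p1 (R : realType) (a b : nat) (ha : (0 < a)%N) (hb : (0 < b)%N) :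
  (forall G : sgraph, bipartite G -> planar R G -> choosable a b G)
  <-> 3 <= a%:R / b%:R :> R.
Proof.
have -> : (3 <= a%:R / b%:R :> R) = (3 * b <= a)%N.
  by rewrite ler_pdivlMr ?ltr0n // -natrM ler_nat.
split=> [all_ch|le_ab G [c c_proper] [dr]].
  apply: double_star_choosable => //; apply: all_ch.
    exact: double_star_bipartite.
  exact: inhabits (double_star_drawing _ _).
exact: (bipartite_planar_choosable c_proper dr le_ab).
Qed.
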